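(* Let $S$ be a positive integer and let $(e_n(s))_{n\ge1,\,1\le s\le S}$ be independent random variables, each uniformly distributed on $\{-1,+1\}$ (equivalently, $G_S(s)=(e_1(s),e_2(s),\dots)$, $1\le s\le S$, is drawn from the space of all such infinite families with the probability measure giving each prescribed assignment of $e_n(i)$, $1\le n\le N$, $1\le i\le S$, probability $2^{-NS}$, for every $N$). Let $G_{N,S}(s)=(e_1(s),\dots,e_N(s))$ for $1\le s\le S$. For every fixed integer $k\ge2$, \[ \frac{\Phi_k(G_{N,S})}{\sqrt{2N\log\binom{N}{k-1}}}\to 1\quad\text{almost surely as } N\to\infty. \]
   Context: For a map $G_{N,S}:\{1,\dots,S\}\to\{-1,+1\}^N$, $G_{N,S}(s)=(e_1(s),\dots,e_N(s))$, the cross-correlation measure of order $k$ is \[ \Phi_k(G_{N,S})=\max\left|\sum_{n=1}^M e_{n+d_1}(s_1)\cdots e_{n+d_k}(s_k)\right|, \] the maximum taken over all integers $M,d_1,\dots,d_k$ and $1\le s_1,\dots,s_k\le S$ with $0\le d_1\le\dots\le d_k<M+d_k\le N$ and $d_i\ne d_j$ whenever $s_i=s_j$. $\log$ is the natural logarithm. *)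

(* Defs.v *)
From mathcomp Require Import all_boot all_order all_algebra.
From mathcomp Require Import all_classical all_reals all_analysis.
Set Implicit Arguments. Unset Strict Implicit. Unset Printing Implicit Defensive.
Import Order.TTheory GRing.Theory Num.Theory.
Local Open Scope ring_scope.

(* A family x n s (n >= 1 position, 1 <= s <= S index of the sequence).
   Phi x N S k is the cross-correlation measure of order k of
   G_{N,S}(s) = (x 1 s, ..., x N s), 1 <= s <= S.
   The maximum ranges over M (1 <= M <= N), shifts d_1 <= ... <= d_k
   (d_i = d i for i : 'I_k) with d_i + M <= N, and indices
   s_1..s_k in {1..S} (s_i = (s i).+1 for s i : 'I_S), with d_i <> d_j
   whenever s_i = s_j (i <> j). *)
Definition Phi {R : realDomainType} (x : nat -> nat -> R) (N S k : nat) : R :=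
  \big[Num.max/0]_(M : 'I_N.+1)
   \big[Num.max/0]_(d : {ffun 'I_k -> 'I_N} |
        [&& (0 < (M : nat))%N,
            [forall i : 'I_k, (d i + M <= N)%N] &
            [forall i : 'I_k, forall j : 'I_k, (i <= j)%N ==> (d i <= d j)%N]])
   \big[Num.max/0]_(s : {ffun 'I_k -> 'I_S} |
        [forall i : 'I_k, forall j : 'I_k,
           ((i != j) && (s i == s j)) ==> (d i != d j)])
     `| \sum_(n < M) \prod_(i < k) x (n.+1 + d i)%N (s i).+1 |.

Definition pm1 {R : pzRingType} (b : bool) : R := if b then 1 else -1.

(* Main.v *)
Require Import Defs.
From mathcomp Require Import all_boot all_order all_algebra.
From mathcomp Require Import all_classical all_reals all_analysis.
From mathcomp Require Import ring lra zify.
Import Order.TTheory GRing.Theory Num.Theory.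
Import numFieldNormedType.Exports.
Local Open Scope classical_set_scope.
Local Open Scope ring_scope.
Set Implicit Arguments. Unset Strict Implicit. Unset Printing Implicit Defensive.

(* Write r = k - 1 and psi(N) = sqrt (2 N r ln N), which is asymptotic to the
   normalisation of the theorem. For the first N terms all families are equally
   likely, and a sum of products e_(n+d_1)(s_1) ... e_(n+d_k)(s_k) over n behaves
   like a martingale: flipping the entry at the largest shift changes the sign of
   the n-th product and leaves the earlier ones alone. Hence cosh x <= exp (x^2 / 2)
   gives Gaussian tails.

   Upper bound: only the O(N^r) relative shifts matter for the union bound, as it
   suffices to control windows with endpoints on a grid of mesh N / Q for a large
   constant Q, and windows shorter than that mesh.

   Lower bound: for about N^r sets of shifts with the same last shift, let W be the
   sum of exp (lam X), X running over the correlation sums of length M that lie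
   close to lam M. For two different sets of shifts the quadratic variation of
   lam (X + X') is 2 lam^2 (M + Z), where Z is again a sum of M signs of the same
   kind and thus negligible. So E W^2 <= (1 + N^-c) (E W)^2, and W = 0 has
   polynomially small probability as soon as lam^2 M / 2 < r ln N.

   Both error probabilities are O(N^-eta), hence summable along N = j^q for q large;
   Borel-Cantelli applies there, and Phi is monotone in N. *)

(** * Hyperbolic cosine *)

Section cosh.
Variable R : realType.
Implicit Types (x : R) (i m : nat).

(** The odd terms cancel. Partial sums of even length are used so that each step adds one even and
    one odd term. *)
Lemma expR_even_series x m :
  series (exp_coeff x) (m * 2)%N + series (exp_coeff (- x)) (m * 2)%N =
  2 * \sum_(i < m) (x ^+ (2 * i) / (2 * i)`!%:R).
Proof.
elim: m => [|m IH]; first by rewrite /series/= !big_geq// big_ord0 addr0 mulr0.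
rewrite big_ord_recr/= mulrDr -IH mulSn add2n /series/= !big_nat_recr//=.
rewrite [(m * 2)%N]mulnC !exp_coeffE/= !exprS !exprM sqrrN.
ring.
Qed.

(** Compares the coefficients of [cosh x] and [exp (x^2 / 2)]: the i factors of (2i)! beyond i! are
    all at least 2. *)
Lemma fact_double_ge i : (2 ^ i * i`! <= (2 * i)`!)%N.
Proof.
elim: i => // i IH; rewrite expnS factS mulnS add2n !factS.
rewrite [X in (_ <= X)%N]mulnA mulnC.
apply: (@leq_trans ((2 * i).+2 * (2 * i)`!)); last first.
  by rewrite leq_mul2r leq_pmulr ?orbT.
by move: IH; nia.
Qed.

Lemma cvg_expR_even x :
  series (exp_coeff x) (m * 2)%N + series (exp_coeff (- x)) (m * 2)%N @[m --> \oo]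
    --> expR x + expR (- x).
Proof.
have h y : series (exp_coeff y) (m * 2)%N @[m --> \oo] --> expR y.
  apply: (@cvg_comp _ _ _ (fun m => m * 2)%N (series (exp_coeff y))).
    exact: cvg_mulnr.
  exact: is_cvg_series_exp_coeff.
by apply: cvgD; exact: h.
Qed.

Lemma cosh_le x : expR x + expR (- x) <= 2 * expR (x ^+ 2 / 2).
Proof.
rewrite -(cvg_lim _ (@cvg_expR_even x))//.
apply: limr_le; first by apply/cvg_ex; eexists; exact: cvg_expR_even.
near=> m; rewrite expR_even_series ler_pM2l//.
have x20 : 0 <= x ^+ 2 / 2 by rewrite divr_ge0 ?sqr_ge0.
apply: (@le_trans _ _ (series (exp_coeff (x ^+ 2 / 2)) m)).
  rewrite /series/= big_mkord; apply: ler_sum => i _.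
  rewrite exp_coeffE/= exprM expr_div_n [leRHS]mulrCA -invfM.
  rewrite ler_wpM2l ?(exprn_ge0 _ (sqr_ge0 x))//.
  rewrite lef_pV2 ?posrE ?ltr0n ?fact_gt0 ?mulr_gt0 ?exprn_gt0 ?ltr0n ?fact_gt0//.
  by rewrite -natrX -natrM ler_nat mulnC fact_double_ge.
apply: nondecreasing_cvgn_le; last exact: is_cvg_series_exp_coeff.
by apply: nondecreasing_series => n _ _; exact: exp_coeff_ge0.
Unshelve. all: end_near. Qed.

(** All terms of the even series are nonnegative, so its first two terms already bound it from
    below. *)
Lemma cosh_ge x : 2 * (1 + x ^+ 2 / 2) <= expR x + expR (- x).
Proof.
rewrite -(cvg_lim _ (@cvg_expR_even x))//.
apply: limr_ge; first by apply/cvg_ex; eexists; exact: cvg_expR_even.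
near=> m; rewrite expR_even_series ler_pM2l//.
have : (2 <= m)%N by near: m; exact: nbhs_infty_ge.
case: {+}m => [//|[//|p]] _; rewrite !big_ord_recl/= expr0 divr1 addrA.
rewrite lerDl sumr_ge0// => i _.
by rewrite exprM mulr_ge0 ?(exprn_ge0 _ (sqr_ge0 x)) ?invr_ge0.
Unshelve. all: end_near. Qed.

(* With u = x^2 / 2: exp (- u / (1 + u)) >= 1 - u / (1 + u) = 1 / (1 + u), and
   u / (1 + u) >= u - u^2. *)
Lemma cosh_ge_expR x :
  2 * expR (x ^+ 2 / 2 - x ^+ 4 / 4) <= expR x + expR (- x).
Proof.
apply: le_trans (cosh_ge x); rewrite ler_pM2l//.
set u := x ^+ 2 / 2; have u0 : 0 <= u by rewrite divr_ge0 ?sqr_ge0.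
have u1 : 0 < 1 + u by rewrite ltr_pwDl.
apply: (@le_trans _ _ (expR (u / (1 + u)))).
  rewrite ler_expR ler_pdivlMr//.
  have -> : x ^+ 4 / 4 = u ^+ 2 by rewrite /u; field.
  have : 0 <= u ^+ 3 by rewrite exprn_ge0.
  lra.
rewrite -[u / (1 + u)]opprK expRN -[leRHS]invrK.
rewrite lef_pV2 ?posrE ?expR_gt0 ?invr_gt0//.
apply: le_trans (expR_ge1Dx _).
by rewrite le_eqVlt; apply/orP; left; apply/eqP; field; rewrite gt_eqF.
Qed.

End cosh.

(** * Flip chains on a finite uniform space *)

Section uniform_expectation.
Variables (R : realType) (T : finType).
Hypothesis T_gt0 : (0 < #|T|)%N.
Implicit Types (F G : T -> R) (D : nat -> T -> R) (fl : nat -> T -> T) (K : nat).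

Definition Ex F : R := (\sum_x F x) / #|T|%:R.

Lemma Ex_le F G : (forall x, F x <= G x) -> Ex F <= Ex G.
Proof. by move=> FG; rewrite ler_wpM2r ?invr_ge0// ler_sum. Qed.

Lemma ExD F G : Ex (fun x => F x + G x) = Ex F + Ex G.
Proof. by rewrite /Ex big_split mulrDl. Qed.

Lemma ExZ c F : Ex (fun x => c * F x) = c * Ex F.
Proof. by rewrite /Ex -mulr_sumr mulrA. Qed.

Lemma Ex_cst c : Ex (fun=> c) = c.
Proof.
by rewrite /Ex sumr_const -[c *+ _]mulr_natr mulfK// pnatr_eq0 -lt0n.
Qed.

Lemma Ex_sum (I : finType) (F : I -> T -> R) :
  Ex (fun x => \sum_i F i x) = \sum_i Ex (F i).
Proof. by rewrite /Ex exchange_big/= mulr_suml. Qed.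

Lemma Ex_reindex (f : T -> T) F : injective f -> Ex (F \o f) = Ex F.
Proof. by move=> fi; rewrite /Ex [in RHS](reindex_inj fi). Qed.

(** An injection of a finite set preserves the uniform law, so [G] may be replaced by [- G] under
    the expectation; the average of the two forms is a hyperbolic cosine. *)
Lemma Ex_symmetrize (f : T -> T) F G : injective f ->
  (forall x, F (f x) = F x) -> (forall x, G (f x) = - G x) ->
  Ex (fun x => F x * expR (G x)) =
  Ex (fun x => F x * ((expR (G x) + expR (- G x)) / 2)).
Proof.
move=> fi Ff Gf.
have e : Ex (fun x => F x * expR (G x)) = Ex (fun x => F x * expR (- G x)).
  rewrite -(Ex_reindex _ fi); congr Ex.
  by apply/funext => x /=; rewrite Ff Gf.
transitivity (2^-1 * (Ex (fun x => F x * expR (G x)) +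
                      Ex (fun x => F x * expR (- G x)))).
  by rewrite -e; field.
by rewrite -ExD -ExZ; congr Ex; apply/funext => x; field.
Qed.

(* D plays the role of a martingale difference sequence: the p-th flip changes
   the sign of D p and leaves the earlier terms alone. *)
Definition flip_chain K D fl :=
  [/\ forall p, injective (fl p),
      forall p x, (p < K)%N -> D p (fl p x) = - D p x &
      forall q p x, (q < p < K)%N -> D q (fl p x) = D q x].

Definition signs D := forall p x, D p x ^+ 2 = 1.

Lemma flip_chainS K D fl : flip_chain K.+1 D fl -> flip_chain K D fl.
Proof.
case=> i a b; split=> // [p x pK|q p x /andP[qp pK]]; first by rewrite a// ltnW.
by rewrite b// qp ltnW.
Qed.

Lemma flip_chainZ c K D fl :
  flip_chain K D fl -> flip_chain K (fun p x => c * D p x) fl.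
Proof.
case=> i a b; split=> // [p x pK|q p x qpK]; first by rewrite a// mulrN.
by rewrite b.
Qed.

Lemma flip_chainD K D D' fl : flip_chain K D fl -> flip_chain K D' fl ->
  flip_chain K (fun p x => D p x + D' p x) fl.
Proof.
move=> [i a b] [_ a' b']; split=> // [p x pK|q p x qpK].
  by rewrite a// a'// opprD.
by rewrite b// b'.
Qed.

(** The last flip fixes the earlier factors and the square of the last term. Symmetrisation turns
    exp (D K) into cosh (D K), which the compensator exp (- D K^2 / 2) absorbs. Steps of any size
    are allowed, as the sum of two sign chains will require. *)
Lemma Ex_supermartingale K D fl : flip_chain K D fl ->
  Ex (fun x => expR (\sum_(p < K) (D p x - D p x ^+ 2 / 2))) <= 1.
Proof.
elim: K => [_|K IH c].
  rewrite -[leRHS](Ex_cst 1); apply: Ex_le => x.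
  by rewrite big_ord0 expR0.
have [fi neg inv] := c.
pose F x := expR (\sum_(p < K) (D p x - D p x ^+ 2 / 2)) * expR (- (D K x ^+ 2 / 2)).
have -> : (fun x => expR (\sum_(p < K.+1) (D p x - D p x ^+ 2 / 2))) =
          (fun x => F x * expR (D K x)).
  by apply/funext => x; rewrite /F big_ord_recr/= -!expRD; congr expR; ring.
rewrite (@Ex_symmetrize (fl K))//; first last.
- by move=> x; rewrite neg.
- move=> x; rewrite /F neg// sqrrN; congr (expR _ * _).
  by apply: eq_bigr => p _; rewrite inv// ltn_ord ltnSn.
apply: le_trans (IH (flip_chainS c)); apply: Ex_le => x.
rewrite /F -mulrA ler_piMr ?expR_ge0// expRN mulrC ler_pdivrMr ?expR_gt0//.
by rewrite mul1r ler_pdivrMr// mulrC; exact: cosh_le.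
Qed.

Lemma Ex_chain_le K D fl (lam : R) : flip_chain K D fl -> signs D ->
  Ex (fun x => expR (lam * \sum_(p < K) D p x)) <= expR (lam ^+ 2 / 2 * K%:R).
Proof.
move=> c s; rewrite -[leRHS]mulr1.
apply: le_trans (ler_wpM2l (expR_ge0 _) (Ex_supermartingale (flip_chainZ lam c))).
rewrite -ExZ; apply: Ex_le => x; rewrite -expRD ler_expR sumrB.
under [X in _ - X]eq_bigr do rewrite exprMn s mulr1.
by rewrite sumr_const card_ord -[X in _ - X]mulr_natr addrCA subrr addr0 mulr_sumr.
Qed.

(** Matches the Gaussian upper bound up to lam^4 / 4 per step; it keeps the mean of the weights
    large in the second moment method. *)
Lemma Ex_chain_ge K D fl (lam : R) : flip_chain K D fl -> signs D ->
  expR ((lam ^+ 2 / 2 - lam ^+ 4 / 4) * K%:R) <=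
  Ex (fun x => expR (lam * \sum_(p < K) D p x)).
Proof.
move=> + s; elim: K => [_|K IH c].
  rewrite -[leLHS](Ex_cst _); apply: Ex_le => x.
  by rewrite big_ord0 !mulr0.
have [fi neg inv] := c.
pose F x := expR (lam * \sum_(p < K) D p x).
have -> : (fun x => expR (lam * \sum_(p < K.+1) D p x)) =
          (fun x => F x * expR (lam * D K x)).
  by apply/funext => x; rewrite /F big_ord_recr/= -expRD mulrDr.
rewrite (@Ex_symmetrize (fl K))//; first last.
- by move=> x; rewrite neg// mulrN.
- move=> x; rewrite /F; congr (expR (_ * _)).
  by apply: eq_bigr => p _; rewrite inv// ltn_ord ltnSn.
apply: (@le_trans _ _ (Ex (fun x => expR (lam ^+ 2 / 2 - lam ^+ 4 / 4) * F x))).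
  rewrite ExZ -(natr1 K) mulrDr mulr1 addrC expRD ler_wpM2l ?expR_ge0//.
  by exact: IH (flip_chainS c).
apply: Ex_le => x; rewrite mulrC ler_wpM2l ?expR_ge0// ler_pdivlMr// mulrC.
have := cosh_ge_expR (lam * D K x).
by rewrite !exprMn s (exprM (D K x) 2 2) s expr1n !mulr1.
Qed.

(** Chernoff bound with the optimal tilt t / l, for both signs. A bound [l] on the length, in place
    of the length itself, gives windows of different lengths the same estimate. *)
Lemma Ex_chain_tail K D fl (l t : R) : flip_chain K D fl -> signs D ->
  0 < l -> K%:R <= l -> 0 <= t ->
  Ex (fun x => (t <= `|\sum_(p < K) D p x|)%R%:R) <= 2 * expR (- (t ^+ 2 / (2 * l))).
Proof.
move=> c s l0 Kl t0; pose lam := t / l; have lam0 : 0 <= lam by rewrite divr_ge0// ltW.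
pose X x := \sum_(p < K) D p x.
apply: (@le_trans _ _ (Ex (fun x => expR (- (lam * t)) *
   (expR (lam * X x) + expR ((- lam) * X x))))).
  apply: Ex_le => x; rewrite -/(X x).
  have [tX|_] := leP t; last by rewrite mulr_ge0 ?addr_ge0 ?expR_ge0.
  rewrite mulrDr -!expRD.
  have [X0|X0] := leP 0 (X x).
    rewrite ger0_norm// in tX.
    apply: (@le_trans _ _ (expR (- (lam * t) + lam * X x))).
      rewrite -[leLHS](expR0) ler_expR addrC subr_ge0 ler_wpM2l//.
    by rewrite lerDl expR_ge0.
  rewrite ltr0_norm// in tX.
  apply: (@le_trans _ _ (expR (- (lam * t) + - lam * X x))).
    by rewrite -[leLHS](expR0) ler_expR addrC mulNr -mulrN subr_ge0 ler_wpM2l.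
  by rewrite lerDr expR_ge0.
rewrite ExZ ExD.
have h u : u ^+ 2 = lam ^+ 2 -> Ex (fun x => expR (u * X x)) <= expR (lam ^+ 2 / 2 * l).
  move=> e; apply: le_trans (Ex_chain_le u c s) _.
  by rewrite ler_expR e ler_wpM2l// divr_ge0 ?sqr_ge0.
apply: (@le_trans _ _ (expR (- (lam * t)) * (expR (lam ^+ 2 / 2 * l) + expR (lam ^+ 2 / 2 * l)))).
  by rewrite ler_wpM2l ?expR_ge0// lerD// h// sqrrN.
rewrite mulrDr -!expRD.
have -> : - (lam * t) + lam ^+ 2 / 2 * l = - (t ^+ 2 / (2 * l)).
  by rewrite /lam; field; rewrite gt_eqF.
by rewrite [leRHS]mulr_natl mulr2n lexx.
Qed.

End uniform_expectation.

(** * Second moment method *)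

Section second_moment.
Variables (R : realType) (T : finType).
Hypothesis T_gt0 : (0 < #|T|)%N.
Variables (I : finType) (M : nat) (D : I -> nat -> T -> R).
Variables (fl : nat -> T -> T).
Hypothesis M_gt0 : (0 < M)%N.
Hypothesis I_gt0 : (0 < #|I|)%N.
Hypothesis D_chain : forall i, flip_chain M (D i) fl.
Hypothesis D_sign : forall i, signs (D i).
Hypothesis DD_chain : forall i j, i != j ->
  exists fl', flip_chain M (fun p x => D i p x * D j p x) fl'.
Variables (lam del z : R).
Hypothesis lam_ge0 : 0 <= lam.
Hypothesis del01 : 0 < del < 1.
Hypothesis z_ge0 : 0 <= z.

Let X i x := \sum_(p < M) D i p x.
(** The lower end of the window is the level to be exceeded; the upper end keeps the second moment
    of the weights under control. exp h is the Gaussian value of the mean of exp (lam X). *)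
Let low := (1 - del) * (lam * M%:R).
Let high := (1 + del) * (lam * M%:R).
Let h := lam ^+ 2 * M%:R / 2.
Let w i x := expR (lam * X i x) * ((low <= X i x <= high)%R%:R).

(* Under the law tilted by exp (lam X), X is concentrated near lam M. *)
Let Ex_w_ge i :
  expR h * (1 - (lam ^+ 4 * M%:R / 4 + 2 * expR (- (del ^+ 2 * h)))) <= Ex (w i).
Proof.
have [d0 d1] := andP del01.
(* The part of exp (lam X) outside the window is bounded by changing the tilt to (1 + del) lam above
   it and to (1 - del) lam below it. *)
apply: (@le_trans _ _ (Ex (fun x => expR (lam * X i x) +
  (- expR (- (del * lam * high)) * expR ((1 + del) * lam * X i x) +
   (- expR (del * lam * low)) * expR ((1 - del) * lam * X i x)))));
  last first.
  apply: Ex_le => x; rewrite /w !mulNr -!expRD -opprD.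
  have [Xl|lX] /= := ltP (X i x) low.
    rewrite mulr0 subr_le0.
    apply: (@le_trans _ _ (expR (del * lam * low + (1 - del) * lam * X i x))).
      rewrite ler_expR -subr_ge0.
      have -> : del * lam * low + (1 - del) * lam * X i x - lam * X i x =
        del * lam * (low - X i x) by ring.
      by rewrite mulr_ge0 ?subr_ge0 ?(ltW Xl)// mulr_ge0 ?(ltW d0).
    by rewrite lerDr expR_ge0.
  have [Xh|hX] /= := leP (X i x) high.
    by rewrite mulr1 gerBl addr_ge0 ?expR_ge0.
  rewrite mulr0 subr_le0.
  apply: (@le_trans _ _ (expR (- (del * lam * high) + (1 + del) * lam * X i x))).
    rewrite ler_expR -subr_ge0.
    have -> : - (del * lam * high) + (1 + del) * lam * X i x - lam * X i x =
      del * lam * (X i x - high) by ring.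
    by rewrite mulr_ge0 ?subr_ge0 ?(ltW hX)// mulr_ge0 ?(ltW d0).
  by rewrite lerDl expR_ge0.
rewrite !ExD !ExZ !mulNr -opprD lerBrDr.
apply: le_trans (Ex_chain_ge T_gt0 lam (D_chain i) (D_sign i)).
have e1 : Ex (fun x => expR ((1 + del) * lam * X i x)) <= expR ((1 + del) ^+ 2 * h).
  apply: le_trans (Ex_chain_le T_gt0 _ (D_chain i) (D_sign i)) _.
  by rewrite ler_expR /h exprMn le_eqVlt; apply/orP; left; apply/eqP; field.
have e2 : Ex (fun x => expR ((1 - del) * lam * X i x)) <= expR ((1 - del) ^+ 2 * h).
  apply: le_trans (Ex_chain_le T_gt0 _ (D_chain i) (D_sign i)) _.
  by rewrite ler_expR /h exprMn le_eqVlt; apply/orP; left; apply/eqP; field.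
have e3 : expR (- (del * lam * high)) * expR ((1 + del) ^+ 2 * h) = expR h * expR (- (del ^+ 2 * h)).
  by rewrite -!expRD; congr expR; rewrite /high /h; field.
have e4 : expR (del * lam * low) * expR ((1 - del) ^+ 2 * h) = expR h * expR (- (del ^+ 2 * h)).
  by rewrite -!expRD; congr expR; rewrite /low /h; field.
have := ler_wpM2l (expR_ge0 (- (del * lam * high))) e1; rewrite e3 => {}e1.
have := ler_wpM2l (expR_ge0 (del * lam * low)) e2; rewrite e4 => {}e2.
have : expR h * (1 - lam ^+ 4 * M%:R / 4) <= expR ((lam ^+ 2 / 2 - lam ^+ 4 / 4) * M%:R).
  have -> : (lam ^+ 2 / 2 - lam ^+ 4 / 4) * M%:R = h + - (lam ^+ 4 * M%:R / 4).
    by rewrite /h; field.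
  by rewrite expRD ler_wpM2l ?expR_ge0 ?expR_ge1Dx.
by move: e1 e2; lra.
Qed.

(** On the window one of the two factors exp (lam X) is at most exp (lam high); only the other one
    is averaged. *)
Let Ex_w2_le i : Ex (fun x => w i x * w i x) <= expR h * expR h * expR ((1 + 2 * del) * h).
Proof.
have -> : expR h * expR h * expR ((1 + 2 * del) * h) = expR (lam * high) * expR h.
  by rewrite -!expRD; congr expR; rewrite /high /h; field.
apply: (@le_trans _ _ (Ex (fun x => expR (lam * high) * expR (lam * X i x)))).
  apply: Ex_le => x; rewrite /w; have [/andP[_ Xh]|] := boolP (low <= _ <= _); last first.
    by move=> _; rewrite !mulr0 mulr_ge0 ?expR_ge0.
  by rewrite !mulr1 ler_wpM2r ?expR_ge0// ler_expR ler_wpM2l.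
rewrite ExZ ler_wpM2l ?expR_ge0//.
apply: le_trans (Ex_chain_le T_gt0 _ (D_chain i) (D_sign i)) _.
by rewrite ler_expR /h le_eqVlt; apply/orP; left; apply/eqP; field.
Qed.

(* (D i + D j)^2 = 2 + 2 D i D j, so that the quadratic variation of X i + X j is
   controlled by the sum Z of the products, which is itself a sum of signs. *)
Let Ex_ww_le i j : i != j -> Ex (fun x => w i x * w j x) <=
  expR h * expR h *
    (expR (lam ^+ 2 * z) + 2 * expR ((2 + 4 * del) * h - z ^+ 2 / (2 * M%:R))).
Proof.
move=> ij; pose Z x := \sum_(p < M) (D i p x * D j p x).
have [fl' c'] := DD_chain ij.
have s' : signs (fun p x => D i p x * D j p x).
  by move=> p x; rewrite exprMn !D_sign mulr1.
pose D2 p x := lam * (D i p x + D j p x).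
have c2 : flip_chain M D2 fl by apply: flip_chainZ; exact: flip_chainD.
have D2E x : \sum_(p < M) (D2 p x - D2 p x ^+ 2 / 2) =
    lam * (X i x + X j x) - lam ^+ 2 * (M%:R + Z x).
  transitivity (\sum_(p < M) (lam * D i p x + lam * D j p x -
      (lam ^+ 2 + lam ^+ 2 * (D i p x * D j p x)))).
    by apply: eq_bigr => p _; rewrite /D2 exprMn sqrrD !D_sign; field.
  rewrite sumrB !big_split/= -!mulr_sumr sumr_const card_ord.
  by rewrite -[_ *+ M]mulr_natr /X /Z; ring.
(* Where |Z| < z, the compensator costs at most lam^2 (M + z) and the supermartingale bound applies.
   Elsewhere the window bounds both weights, and the tail of [Z] pays for that bound. *)
apply: (@le_trans _ _ (Ex (fun x =>
    expR (lam ^+ 2 * (M%:R + z)) * expR (\sum_(p < M) (D2 p x - D2 p x ^+ 2 / 2)) +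
    expR (2 * lam * high) * (z <= `|Z x|)%R%:R))).
  apply: Ex_le => x; rewrite D2E -expRD /w.
  have [/andP[_ Xi]|] := boolP (low <= X i x <= _); last first.
    by move=> _; rewrite mulr0 mul0r addr_ge0 ?mulr_ge0 ?expR_ge0.
  have [/andP[_ Xj]|] := boolP (low <= X j x <= _); last first.
    by move=> _; rewrite !mulr0 addr_ge0 ?mulr_ge0 ?expR_ge0.
  rewrite !mulr1 -expRD -mulrDr.
  have [zZ|Zz] /= := leP z `|Z x|.
    apply: (@le_trans _ _ (expR (2 * lam * high))); last first.
      by rewrite mulr1 lerDr expR_ge0.
    by rewrite ler_expR [2 * lam]mulrC -mulrA ler_wpM2l//; lra.
  rewrite mulr0 addr0 ler_expR.
  have -> : lam ^+ 2 * (M%:R + z) + (lam * (X i x + X j x) - lam ^+ 2 * (M%:R + Z x)) =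
    lam * (X i x + X j x) + lam ^+ 2 * (z - Z x) by ring.
  by rewrite lerDl mulr_ge0 ?sqr_ge0// subr_ge0 (le_trans (ler_norm _))// ltW.
rewrite ExD !ExZ [leRHS]mulrDr; apply: lerD.
  apply: le_trans (ler_wpM2l (expR_ge0 _) (Ex_supermartingale T_gt0 c2)) _.
  by rewrite mulr1 -!expRD ler_expR /h le_eqVlt; apply/orP; left; apply/eqP; field.
have M0 : (0 : R) < M%:R by rewrite ltr0n.
have tail := Ex_chain_tail T_gt0 c' s' M0 (lexx _) z_ge0.
apply: le_trans (ler_wpM2l (expR_ge0 (2 * lam * high)) tail) _.
rewrite !(mulrCA _ 2) ler_pM2l// -!expRD ler_expR /high /h le_eqVlt.
by apply/orP; left; apply/eqP; field; rewrite gt_eqF.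
Qed.

(** Chebyshev's inequality around m = #|I| exp h instead of the mean: if all sums lie below the
    window, then W = 0 and (W - m)^2 = m^2. This takes a lower bound on E W and an upper bound on E
    W^2; the diagonal of W^2 gives the term divided by #|I|. *)
Lemma second_moment_bound :
  Ex (fun x => [forall i, \sum_(p < M) D i p x < (1 - del) * (lam * M%:R)]%:R : R) <=
    2 * (lam ^+ 4 * M%:R / 4 + 2 * expR (- (del ^+ 2 * h))) +
    ((expR (lam ^+ 2 * z) - 1) +
     2 * expR ((2 + 4 * del) * h - z ^+ 2 / (2 * M%:R)) +
     expR ((1 + 2 * del) * h) / #|I|%:R).
Proof.
set a := (X in 2 * X + _); set b := (X in _ + X).
pose n : R := #|I|%:R; have n0 : 0 < n by rewrite ltr0n.
pose m := n * expR h; have m0 : 0 < m by rewrite mulr_gt0// expR_gt0.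
pose W x := \sum_i w i x.
have m20 : 0 < m ^+ 2 by rewrite exprn_gt0.
rewrite -(ler_pM2l m20) -ExZ.
apply: (@le_trans _ _ (Ex (fun x => (W x * W x + (- (2 * m)) * W x) + m ^+ 2))).
  apply: Ex_le => x; case: (boolP [forall i, _]) => [/forallP lt|]; last first.
    have -> : W x * W x + - (2 * m) * W x + m ^+ 2 = (W x - m) ^+ 2 by ring.
    by move=> _; rewrite mulr0 sqr_ge0.
  have -> : W x = 0; last by rewrite !mulr0 !add0r mulr1.
  rewrite /W big1// => i _; rewrite /w.
  by have := lt i; rewrite ltNge => /negbTE; rewrite /low /X => ->; rewrite mulr0.
rewrite !ExD ExZ Ex_cst//.
have EW : n * (expR h * (1 - a)) <= Ex W.
  rewrite /W Ex_sum /n mulr_natl -sumr_const; apply: ler_sum => i _.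
  exact: Ex_w_ge.
pose B := expR h * expR h *
    (expR (lam ^+ 2 * z) + 2 * expR ((2 + 4 * del) * h - z ^+ 2 / (2 * M%:R))).
have B0 : 0 <= B by rewrite /B !mulr_ge0 ?addr_ge0 ?mulr_ge0 ?expR_ge0.
have EW2 : Ex (fun x => W x * W x) <=
    n * (expR h * expR h * expR ((1 + 2 * del) * h)) + n * (n * B).
  have -> : (fun x => W x * W x) = (fun x => \sum_i \sum_j w i x * w j x).
    by apply/funext => x; rewrite /W mulr_suml; apply: eq_bigr => i _; rewrite mulr_sumr.
  rewrite Ex_sum -mulrDr {1}/n mulr_natl -sumr_const; apply: ler_sum => i _.
  rewrite Ex_sum (bigD1 i)//= lerD ?Ex_w2_le//.
  apply: (@le_trans _ _ (\sum_(j | j != i) B)).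
    by apply: ler_sum => j ji; apply: Ex_ww_le; rewrite eq_sym.
  rewrite /n mulr_natl -sumr_const [leRHS](bigID (fun j => j != i))/= lerDl.
  by rewrite sumr_ge0.
apply: (@le_trans _ _ (n * (expR h * expR h * expR ((1 + 2 * del) * h)) + n * (n * B)
   + - (2 * m) * (n * (expR h * (1 - a))) + m ^+ 2)).
  by rewrite lerD2r lerD// ler_wnM2l// oppr_le0 mulr_ge0// ltW.
rewrite /m /b /B -/n le_eqVlt; apply/orP; left; apply/eqP; field.
by rewrite gt_eqF.
Qed.

End second_moment.

(** * Sign arrays and correlation sums *)

Section sign_arrays.
Variables (R : realType) (N S : nat).
Notation Om := {ffun 'I_N * 'I_S -> bool}.
Implicit Types (x : Om) (n s p q : nat).

(* The entry at position n >= 1 of sequence s >= 1; it is 1 outside the array. *)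
Definition sg x n s : R :=
  \prod_(c : 'I_N * 'I_S | (c.1.+1 == n) && (c.2.+1 == s)) pm1 (x c).

Definition flip n s x : Om := [ffun c => x c (+) ((c.1.+1 == n) && (c.2.+1 == s))].

Lemma flip_inj n s : injective (flip n s).
Proof.
apply: (can_inj (g := flip n s)) => x.
by apply/ffunP => c; rewrite !ffunE -addbA addbb addbF.
Qed.

Lemma sgE x (i : 'I_N) (j : 'I_S) : sg x i.+1 j.+1 = pm1 (x (i, j)).
Proof. by rewrite /sg (big_pred1 (i, j)). Qed.

Lemma sg_sqr x n s : sg x n s ^+ 2 = 1.
Proof.
rewrite /sg -prodrXl big1// => c _.
by case: (x c); rewrite /pm1 ?sqrrN expr1n.
Qed.

Lemma sg_flip x n s : (0 < n <= N)%N -> (0 < s <= S)%N ->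
  sg (flip n s x) n s = - sg x n s.
Proof.
case: n => // n; case: s => // s /= nN sS.
rewrite -[n]/(val (Ordinal nN)) -[s]/(val (Ordinal sS)) !sgE ffunE/= !eqxx addbT.
by case: (x _); rewrite /pm1 ?opprK.
Qed.

Lemma sg_flip_neq x n s n' s' : (n', s') != (n, s) ->
  sg (flip n s x) n' s' = sg x n' s'.
Proof.
move=> ne; apply: eq_bigr => c /andP[/eqP c1 /eqP c2].
by rewrite ffunE c1 c2 -[X in _ (+) X]/((n', s') == (n, s)) (negPf ne) addbF.
Qed.

Lemma card_sign_arrays_gt0 : (0 < #|{: Om}|)%N.
Proof. by apply/card_gt0P; exists [ffun=> true]. Qed.

(** [p] counts from 0 and stands for the summand n = p + 1. *)
Definition corr (y : nat -> nat -> R) k (d : 'I_k -> nat) (s : 'I_k -> 'I_S) p :=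
  \prod_(i < k) y (p.+1 + d i)%N (s i).+1.

Lemma corr_sign k (d : 'I_k -> nat) (s : 'I_k -> 'I_S) :
  signs (fun p x => corr (sg x) d s p).
Proof. by move=> p x; rewrite -prodrXl big1// => i _; rewrite sg_sqr. Qed.

(* The entry at the largest shift occurs in the p-th product but in no earlier one. *)
Lemma corr_chain r K (d : 'I_r.+1 -> nat) (s : 'I_r.+1 -> 'I_S) :
  (forall i, (d i <= d ord_max)%N) ->
  (forall i, i != ord_max -> s i = s ord_max -> d i <> d ord_max) ->
  (K + d ord_max <= N)%N ->
  flip_chain K (fun p x => corr (sg x) d s p)
    (fun p => flip (p.+1 + d ord_max)%N (s ord_max).+1).
Proof.
move=> dmax dist KN; split=> [p|p x pK|q p x /andP[qp pK]].
- exact: flip_inj.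
- rewrite /corr (bigD1 ord_max)//= sg_flip ?ltn_ord//; last by lia.
  rewrite mulNr [in RHS](bigD1 ord_max)//=; congr (- (_ * _)).
  apply: eq_bigr => i im; apply: sg_flip_neq.
  apply/eqP => -[e1 e2]; apply: (dist i im); last by lia.
  exact/val_inj.
- apply: eq_bigr => i _; apply: sg_flip_neq.
  by apply/eqP => -[e1 _]; have := dmax i; lia.
Qed.

Lemma corr_sum_tail r K (d : 'I_r.+1 -> nat) (s : 'I_r.+1 -> 'I_S) (l t : R) :
  (forall i, (d i <= d ord_max)%N) ->
  (forall i, i != ord_max -> s i = s ord_max -> d i <> d ord_max) ->
  (K + d ord_max <= N)%N -> 0 < l -> K%:R <= l -> 0 <= t ->
  Ex (fun x => (t <= `|\sum_(p < K) corr (sg x) d s p|)%R%:R) <=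
    2 * expR (- (t ^+ 2 / (2 * l))).
Proof.
move=> h1 h2 h3; apply: (Ex_chain_tail card_sign_arrays_gt0 (corr_chain h1 h2 h3)).
exact: corr_sign.
Qed.

End sign_arrays.

(** * Bounds, monotonicity and locality of the correlation measure *)

Section Phi.
Variables (R : realType) (S : nat).
Implicit Types (y : nat -> nat -> R) (N M k : nat).

(** The range of the maximum in [Phi] as a proposition, with shifts in [nat] so that no ordinals
    have to be built. *)
Definition admissible N M k (d : 'I_k -> nat) (s : 'I_k -> 'I_S) :=
  [/\ (0 < M)%N, (forall i, d i + M <= N)%N,
      (forall i j : 'I_k, (i <= j)%N -> (d i <= d j)%N) &
      (forall i j, i != j -> s i = s j -> d i <> d j)].

Lemma Phi_ge y N M k (d : 'I_k -> nat) (s : 'I_k -> 'I_S) :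
  (0 < k)%N -> admissible N M d s ->
  `|\sum_(p < M) corr y d s p| <= Phi y N S k.
Proof.
move=> k0 [M0 dM dmon dist].
have MN : (M < N.+1)%N by have := dM (Ordinal k0); lia.
have dN i : (d i < N)%N by have := dM i; lia.
rewrite /Phi; apply: (@Order.TotalTheory.bigmax_sup _ _ _ _ (Ordinal MN)) => //.
apply: (@Order.TotalTheory.bigmax_sup _ _ _ _ [ffun i => Ordinal (dN i)]).
  rewrite M0/=; apply/andP; split.
    by apply/forallP => i; rewrite ffunE/=.
  by apply/forallP => i; apply/forallP => j; rewrite !ffunE/=; apply/implyP/dmon.
apply: (@Order.TotalTheory.bigmax_sup _ _ _ _ [ffun i => s i]).
  apply/forallP => i; apply/forallP => j; rewrite !ffunE/=.
  apply/implyP => /andP[ij /eqP sij]; apply/eqP => -[dij].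
  exact: dist sij dij.
rewrite le_eqVlt; apply/orP; left; apply/eqP; congr `| _ |; apply: eq_bigr => p _.
by apply: eq_bigr => i _; rewrite !ffunE.
Qed.

Lemma Phi_le y N k (c : R) : 0 <= c ->
  (forall M (d : 'I_k -> nat) (s : 'I_k -> 'I_S), admissible N M d s ->
     `|\sum_(p < M) corr y d s p| <= c) ->
  Phi y N S k <= c.
Proof.
move=> c0 H; apply: bigmax_le => // M _; apply: bigmax_le => // d /and3P[M0 dM dmon].
apply: bigmax_le => // s dist; apply: (H M (fun i => d i : nat) s); split=> //.
- by move=> i; exact: (forallP dM i).
- by move=> i j; exact/implyP/(forallP (forallP dmon i) j).
- move=> i j ij sij dij; have := forallP (forallP dist i) j.
  by rewrite ij sij eqxx/= => /eqP; apply; exact/val_inj.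
Qed.

Lemma Phi_ge0 y N k : 0 <= Phi y N S k.
Proof. exact: bigmax_ge_id. Qed.

Lemma Phi_mono y N N' k : (0 < k)%N -> (N <= N')%N -> Phi y N S k <= Phi y N' S k.
Proof.
move=> k0 NN; apply: Phi_le; first exact: Phi_ge0.
move=> M d s [M0 dM dmon dist]; apply: Phi_ge => //; split=> // i.
exact: leq_trans (dM i) NN.
Qed.

(** Passes from the infinite random sequences to a finite sign array. *)
Lemma eq_Phi y y' N k :
  (forall n s, (n < N)%N -> (s < S)%N -> y n.+1 s.+1 = y' n.+1 s.+1) ->
  Phi y N S k = Phi y' N S k.
Proof.
move=> yy; rewrite /Phi; apply: eq_bigr => M _; apply: eq_bigr => d /and3P[_ dM _].
apply: eq_bigr => s _; congr `| _ |; apply: eq_bigr => p _; apply: eq_bigr => i _.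
rewrite addSn yy// ; have := forallP dM i; have := ltn_ord p; lia.
Qed.

End Phi.

(** * Upper tail *)

Lemma Ex_union (R : realType) (T I : finType) (B : pred T) (F : I -> pred T) (c : R) :
  (forall x, B x -> exists i, F i x) ->
  (forall i, Ex (fun x => (F i x)%:R) <= c) ->
  Ex (fun x => (B x)%:R) <= #|I|%:R * c.
Proof.
move=> BF Fc.
apply: (@le_trans _ _ (Ex (fun x => \sum_i (F i x)%:R))).
  apply: Ex_le => x; have [Bx|_] := boolP (B x); last by rewrite sumr_ge0.
  by have [i Fi] := BF x Bx; rewrite (bigD1 i)//= Fi lerDl sumr_ge0.
rewrite Ex_sum mulr_natl -sumr_const; apply: ler_sum => i _; exact: Fc.
Qed.

Section upper_bound.
Variables (R : realType) (N S r Q h : nat).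
Notation Om := {ffun 'I_N * 'I_S -> bool}.
Hypotheses (N_gt0 : (0 < N)%N) (h_gt0 : (0 < h)%N) (N_lt : (N < Q.+1 * h)%N).
Implicit Types (f : {ffun 'I_r -> 'I_N}) (s : {ffun 'I_r.+1 -> 'I_S}).

(** Shifts relative to the first one, which becomes 0; the starting point of the window carries the
    rest. This leaves N^r choices instead of N^(r+1). *)
Let dd f (i : 'I_r.+1) : nat := if unlift ord0 i is Some j then f j else 0.

(** What the flip argument asks of the shifts: the last one is the largest, and no other shift of
    the same sequence equals it. *)
Let good f s := [forall i, (dd f i <= dd f ord_max)%N] &&
  [forall i, (i != ord_max) && (s i == s ord_max) ==> (dd f i != dd f ord_max)].

Let win (y : nat -> nat -> R) f s a K : R :=
  \sum_(p < K) corr y (fun i => a + dd f i)%N s p.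

(** The event is empty when the window does not fit into the first [N] terms, so the tail bound
    holds for all parameters. *)
Let ev (t : R) f s a K (x : Om) :=
  [&& good f s, (K + (a + dd f ord_max) <= N)%N & t <= `|win (@sg R _ _ x) f s a K|].

Let win_split y f s a K K' :
  win y f s a (K + K') = win y f s a K + win y f s (a + K) K'.
Proof.
rewrite /win big_split_ord/=; congr (_ + _); apply: eq_bigr => p _.
by apply: eq_bigr => i _; congr y => /=; lia.
Qed.

Let Ex_ev t f s a K (l : R) : 0 < l -> K%:R <= l -> 0 <= t ->
  Ex (fun x => (ev t f s a K x)%:R) <= 2 * expR (- (t ^+ 2 / (2 * l))).
Proof.
move=> l0 Kl t0.
have [/andP[g KN]|ng] := boolP (good f s && (K + (a + dd f ord_max) <= N)%N).
  apply: (@le_trans _ _ (Ex (fun x => (t <= `|win (sg R x) f s a K|)%R%:R))).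
    by apply: Ex_le => x; rewrite /ev g KN.
  apply: corr_sum_tail => //.
    move=> i; rewrite leq_add2l; case/andP: g => /forallP g _; exact: g.
  move=> i im si /eqP; rewrite eqn_add2l; apply/negP.
  by case/andP: g => _ /forallP/(_ i); rewrite im si eqxx.
rewrite (_ : (fun x => _) = fun=> 0); last first.
  by apply/funext => x; rewrite /ev andbA (negPf ng).
by rewrite Ex_cst ?mulr_ge0 ?expR_ge0// card_sign_arrays_gt0.
Qed.

(* Any window is a difference of a window with endpoints on the grid of mesh h
   and of windows of length less than h that start on the grid. *)
Let Phi_le_windows (t1 t2 : R) (x : Om) : 0 <= t1 -> 0 <= t2 ->
  (forall f s (i j : 'I_Q.+1), ~~ ev t1 f s (i * h) ((j - i) * h) x) ->
  (forall f s (a : 'I_N.+1), ~~ ev t2 f s (a %/ h * h) (a - a %/ h * h) x) ->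
  Phi (@sg R _ _ x) N S r.+1 <= t1 + 2 * t2.
Proof.
move=> t10 t20 H1 H2; apply: Phi_le; first by rewrite addr_ge0// mulr_ge0.
move=> M d s0 [M0 dM dmon dist].
have dN (j : 'I_r) : (d (lift ord0 j) - d ord0 < N)%N by have := dM (lift ord0 j); lia.
pose f : {ffun 'I_r -> 'I_N} := [ffun j => Ordinal (dN j)].
pose s : {ffun 'I_r.+1 -> 'I_S} := [ffun i => s0 i].
have ddE i : dd f i = (d i - d ord0)%N.
  rewrite /dd; case: unliftP => [j ->|->]; first by rewrite ffunE.
  by rewrite subnn.
have d0 i : (d ord0 <= d i)%N by apply: dmon.
have gd : good f s.
  apply/andP; split; apply/forallP => i.
    by rewrite !ddE leq_sub2r// dmon// -ltnS ltn_ord.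
  rewrite !ddE !ffunE; apply/implyP => /andP[im /eqP si]; apply/eqP => e.
  apply: (dist i ord_max im si); have := d0 i; have := d0 ord_max; lia.
set a := d ord0; pose b := (a + M)%N.
have bN : (b + dd f ord_max <= N)%N.
  by rewrite ddE /b; have := d0 ord_max; have := dM ord_max; rewrite /a; lia.
have -> : \sum_(p < M) corr (sg R x) d s0 p = win (sg R x) f s a M.
  apply: eq_bigr => p _; apply: eq_bigr => i _; rewrite ffunE ddE.
  by congr (sg R x _ _); have := d0 i; rewrite /a; lia.
have ga := leq_trunc_div a h; have gb := leq_trunc_div b h.
have gab : (a %/ h <= b %/ h)%N by apply: leq_div2r; rewrite leq_addr.
have gab' : (a %/ h * h <= b %/ h * h)%N by rewrite leq_mul2r gab orbT.
have qa c : (c <= N)%N -> (c %/ h < Q.+1)%N.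
  by move=> cN; rewrite ltn_divLR//; apply: leq_ltn_trans N_lt.
have aN : (a < N.+1)%N by rewrite /b in bN; lia.
have bN' : (b < N.+1)%N by lia.
have short c : (c < N.+1)%N -> (c + dd f ord_max <= N)%N ->
    `|win (sg R x) f s (c %/ h * h) (c - c %/ h * h)| <= t2.
  move=> cN cdN; have := H2 f s (Ordinal cN); rewrite /ev gd/= => /nandP[|].
    by have := leq_trunc_div c h; lia.
  by rewrite -ltNge => /ltW.
have sa := short a aN; have sb := short b bN' bN.
have {}sa : `|win (sg R x) f s (a %/ h * h) (a - a %/ h * h)| <= t2.
  by apply: sa; rewrite /b in bN; lia.
have long : `|win (sg R x) f s (a %/ h * h) ((b %/ h - a %/ h) * h)| <= t1.
  have ha : (a %/ h < Q.+1)%N by apply: qa; rewrite -ltnS.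
  have hb : (b %/ h < Q.+1)%N by apply: qa; rewrite -ltnS.
  have := H1 f s (Ordinal ha) (Ordinal hb); rewrite /ev gd/= => /nandP[|].
    by rewrite mulnBl; lia.
  by rewrite -ltNge => /ltW.
(* The stretch from the grid point below [a] up to [b] is split once at [a] and once at the grid
   point below [b]. Comparing the two expresses the window through one grid window and two short
   ones. *)
have e1 := win_split (sg R x) f s (a %/ h * h) (a - a %/ h * h) M.
have e2 := win_split (sg R x) f s (a %/ h * h) ((b %/ h - a %/ h) * h) (b - b %/ h * h).
rewrite subnKC// in e1.
rewrite mulnBl subnKC// -mulnBl in e2.
have e3 : (a - a %/ h * h + M = (b %/ h - a %/ h) * h + (b - b %/ h * h))%N.
  by rewrite mulnBl /b; rewrite /b in gb gab'; lia.
rewrite e3 e2 in e1.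
have -> : win (sg R x) f s a M =
  win (sg R x) f s (a %/ h * h) ((b %/ h - a %/ h) * h) +
  win (sg R x) f s (b %/ h * h) (b - b %/ h * h) -
  win (sg R x) f s (a %/ h * h) (a - a %/ h * h) by rewrite e1; ring.
apply: le_trans (ler_normB _ _) _.
apply: le_trans (lerD (ler_normD _ _) (lexx _)) _.
by move: sa sb long; lra.
Qed.

(** Union bound over the relative shifts and sequence indices, combined with pairs of grid points
    (length at most N) or with end points of short windows (length at most h). *)
Lemma Phi_upper_tail (t1 t2 : R) : 0 <= t1 -> 0 <= t2 ->
  Ex (fun x : Om => (t1 + 2 * t2 < Phi (sg R x) N S r.+1)%R%:R) <=
    (N ^ r * S ^ r.+1 * (Q.+1 * Q.+1))%:R * (2 * expR (- (t1 ^+ 2 / (2 * N%:R)))) +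
    (N ^ r * S ^ r.+1 * N.+1)%:R * (2 * expR (- (t2 ^+ 2 / (2 * h%:R)))).
Proof.
move=> t10 t20.
pose I1 := ({ffun 'I_r -> 'I_N} * {ffun 'I_r.+1 -> 'I_S} * ('I_Q.+1 * 'I_Q.+1))%type.
pose I2 := ({ffun 'I_r -> 'I_N} * {ffun 'I_r.+1 -> 'I_S} * 'I_N.+1)%type.
(* The grid may reach beyond [N]; the guard makes the tail bound with l = N applicable to every
   [u]. *)
pose F1 (u : I1) (x : Om) := (((u.2.2 - u.2.1) * h)%:R <= (N%:R : R)) &&
  ev t1 u.1.1 u.1.2 (u.2.1 * h) ((u.2.2 - u.2.1) * h) x.
pose F2 (u : I2) := ev t2 u.1.1 u.1.2 (u.2 %/ h * h) (u.2 - u.2 %/ h * h).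
pose B1 x := [exists u, F1 u x]; pose B2 x := [exists u, F2 u x].
apply: (@le_trans _ _ (Ex (fun x => (B1 x)%:R + (B2 x)%:R))).
  apply: Ex_le => x; have [|b1] /= := boolP (B1 x).
    move=> _; apply: (@le_trans _ _ 1); first by case: (_ < Phi _ _ _ _)%R.
    by rewrite lerDl.
  have [|b2] /= := boolP (B2 x); first by move=> _; rewrite add0r; case: (_ < Phi _ _ _ _)%R.
  rewrite addr0 ltNge Phi_le_windows//.
    move=> f s i j; apply/negP => e; case/existsP: b1; exists (f, s, (i, j)).
    rewrite /F1 e andbT/= ler_nat; case/and3P: e => _ + _; lia.
  by move=> f s a; apply/negP => e; case/existsP: b2; exists (f, s, a).
have cardE (J : finType) : #|{: {ffun 'I_r -> 'I_N} * {ffun 'I_r.+1 -> 'I_S} * J}| = (N ^ r * S ^ r.+1 * #|J|)%N.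
  by rewrite !card_prod !card_ffun !card_ord.
rewrite ExD; apply: lerD.
  have -> : (Q.+1 * Q.+1 = #|{: 'I_Q.+1 * 'I_Q.+1}|)%N by rewrite card_prod card_ord.
  rewrite -cardE; apply: (@Ex_union _ _ _ _ F1) => [x /existsP//|u].
  have [KN|nK] := boolP (((u.2.2 - u.2.1) * h)%:R <= (N%:R : R)); last first.
    rewrite (_ : (fun x => _) = fun=> 0); last by apply/funext => x; rewrite /F1 (negPf nK).
    by rewrite Ex_cst ?mulr_ge0 ?expR_ge0// card_sign_arrays_gt0.
  apply: le_trans (Ex_ev u.1.1 u.1.2 (u.2.1 * h) _ KN t10); last by rewrite ltr0n.
  by apply: Ex_le => x; rewrite /F1 KN lexx.
rewrite -[in leRHS](card_ord N.+1) -cardE.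
apply: (@Ex_union _ _ _ _ F2) => [x /existsP//|u].
apply: Ex_ev => //; first by rewrite ltr0n.
by rewrite ler_nat; have := divn_eq u.2 h; have := ltn_pmod u.2 h_gt0; lia.
Qed.

End upper_bound.

(** * Lower tail *)

Section lower_bound.
Variables (R : realType) (N S' r H M : nat).
Notation S := S'.+1.
Notation Om := {ffun 'I_N * 'I_S -> bool}.
Hypotheses (M_gt0 : (0 < M)%N) (H_gt0 : (0 < H)%N) (MH_le : (M + r * H <= N)%N).
Implicit Types (f g : {ffun 'I_r -> 'I_H}) (i : 'I_r.+1).

Let ee f i : nat := if unlift ord_max i is Some j then f j else 0.

(* The i-th shift runs through the i-th block of length H, and the last one is
   r * H for every f. *)
Let sh f i : nat := (i * H + ee f i)%N.

(** All products are taken inside the first sequence, which suffices for a lower bound; the blocks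
    make the shifts distinct. *)
Let s0 i : 'I_S := ord0.

Let ee_max f : ee f ord_max = 0%N.
Proof. by rewrite /ee unlift_none. Qed.

Let ee_lt f i : (ee f i < H)%N.
Proof. by rewrite /ee; case: unlift. Qed.

Let sh_lt f g i i' : (i < i')%N -> (sh f i < sh g i')%N.
Proof.
move=> ii; rewrite /sh; have := ee_lt f i.
have : (i.+1 * H <= i' * H)%N by rewrite leq_mul2r ii orbT.
rewrite mulSn; lia.
Qed.

Let sh_le_max f i : (sh f i <= r * H)%N.
Proof.
have -> : (r * H = sh f ord_max)%N by rewrite /sh ee_max addn0.
have [ir|] := ltnP i r; first by rewrite ltnW// sh_lt.
by move=> ri; rewrite (_ : i = ord_max)//; apply: val_inj => /=; have := ltn_ord i; lia.
Qed.

Let sh_mono f i i' : (i <= i')%N -> (sh f i <= sh f i')%N.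
Proof.
rewrite leq_eqVlt => /orP[/eqP/val_inj ->//|ii]; exact: ltnW (sh_lt _ _ _).
Qed.

Let sh_adm f : admissible N M (sh f) s0.
Proof.
split=> // [i|i i'|i i' ii _]; first by have := sh_le_max f i; lia.
- exact: sh_mono.
- by move=> e; move: ii; rewrite -val_eqE neq_ltn => /orP[] /(sh_lt f f); rewrite e ltnn.
Qed.

Let Df f p (x : Om) : R := corr (sg R x) (sh f) s0 p.

Let Df_chain f : flip_chain M (Df f) (fun p => @flip N S (p.+1 + r * H) 1).
Proof.
have e : (r * H = sh f ord_max)%N by rewrite /sh ee_max addn0.
rewrite e; apply: (@corr_chain R N S r M (sh f) s0).
- by move=> i; rewrite -e.
- by move=> i im _ ei; have [_ _ _ /(_ _ _ im erefl)] := sh_adm f.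
- by rewrite -e.
Qed.

(* In the product of two sequences the entries common to both cancel, and the
   largest of the remaining ones occurs in no earlier term. *)
Let DfDf_chain f g : f != g ->
  exists fl', flip_chain M (fun p x => Df f p x * Df g p x) fl'.
Proof.
move=> fg.
have [j0 fgj] : exists j, f j != g j.
  apply/existsP; apply: contraR fg; rewrite negb_exists => /forallP fg.
  by apply/eqP/ffunP => j; apply/eqP; have := fg j; rewrite negbK.
have ex : exists n, [exists i : 'I_r.+1, (n == i :> nat) && (ee f i != ee g i)].
  exists (lift ord_max j0); apply/existsP; exists (lift ord_max j0).
  by rewrite eqxx /ee liftK.
have bd n : [exists i : 'I_r.+1, (n == i :> nat) && (ee f i != ee g i)] -> (n <= r)%N.
  by case/existsP => i /andP[/eqP -> _]; rewrite -ltnS.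
case: (ex_maxnP ex bd) => n /existsP[i0 /andP[/eqP ni0 ne0]] max0.
have eq_above i : (i0 < i)%N -> sh f i = sh g i.
  move=> ii; rewrite /sh; congr (_ + _)%N; apply/eqP; apply: contraLR ii => ne.
  rewrite -leqNgt -ni0; apply: max0; apply/existsP; exists i.
  by rewrite eqxx.
(* [i0] is the last index at which [f] and [g] disagree: the factors above it are squares of signs,
   and those below it lie at smaller positions than [c p]. *)
pose c p := (p.+1 + maxn (sh f i0) (sh g i0))%N.
exists (fun p => flip (c p) 1).
pose fac p (x : Om) i := sg R x (p.+1 + sh f i) 1 * sg R x (p.+1 + sh g i) 1.
have facE p x : Df f p x * Df g p x = \prod_i fac p x i by rewrite /Df /corr -big_split.
have i0r : (i0 < r)%N.
  rewrite ltn_neqAle -ltnS ltn_ord andbT; apply: contra ne0 => /eqP i0r.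
  by rewrite (_ : i0 = ord_max) ?ee_max//; exact: val_inj.
have shi0 f' : (sh f' i0 <= r * H)%N by exact: sh_le_max.
have sg_lt q p (x : Om) m : (q.+1 + m < c p)%N -> sg R (flip (c p) 1 x) (q.+1 + m) 1 = sg R x (q.+1 + m) 1.
  by move=> lt; apply: sg_flip_neq; rewrite xpair_eqE (ltn_eqF lt).
have fac_above q p x i : (i0 < i)%N -> fac q (flip (c p) 1 x) i = fac q x i.
  by move=> ii; rewrite /fac eq_above// -!expr2 !sg_sqr.
split=> [p|p x pM|q p x /andP[qp pM]]; first exact: flip_inj.
- rewrite !facE (bigD1 i0)//= [in RHS](bigD1 i0)//= -mulNr; congr (_ * _).
    have cN : (0 < c p <= N)%N.
      have := shi0 f; have := shi0 g; move: MH_le pM; rewrite /c.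
      move: (sh f i0) (sh g i0) (r * H)%N => u v w; lia.
    rewrite /fac; have [fg0|gf0|e] := ltngtP (sh f i0) (sh g i0).
    + have cE : c p = (p.+1 + sh g i0)%N by rewrite /c (maxn_idPr (ltnW fg0)).
      have lt : (p.+1 + sh f i0 < c p)%N by rewrite cE ltn_add2l.
      by rewrite (sg_lt _ _ _ _ lt) -cE sg_flip// mulrN.
    + have cE : c p = (p.+1 + sh f i0)%N by rewrite /c (maxn_idPl (ltnW gf0)).
      have lt : (p.+1 + sh g i0 < c p)%N by rewrite cE ltn_add2l.
      by rewrite (sg_lt _ _ _ _ lt) -cE sg_flip// mulNr.
    + by case/negP: ne0; move/eqP: e; rewrite /sh eqn_add2l.
  apply: eq_bigr => i ii; have [lt|lt|e] := ltngtP i i0.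
  + rewrite /fac !sg_lt// /c ltn_add2l leq_max sh_lt// orbT//.
  + exact: fac_above.
  + by case/negP: ii; apply/eqP; exact: val_inj.
- rewrite !facE; apply: eq_bigr => i _.
  have [lt|lt|/val_inj ->] := ltngtP i i0; last first.
  + by rewrite /fac !sg_lt// /c; lia.
  + exact: fac_above.
  + have := sh_lt f f lt; have := sh_lt g g lt.
    by move=> h1 h2; rewrite /fac !sg_lt// /c; lia.
Qed.

(** The exponent [h] is a variable with an equation so that a simplified form can be supplied
    later. *)
Lemma Phi_lower_tail (lam del z : R) : 0 <= lam -> 0 < del < 1 -> 0 <= z ->
  forall h, h = lam ^+ 2 * M%:R / 2 ->
  Ex (fun x : Om => (Phi (sg R x) N S r.+1 < (1 - del) * (lam * M%:R))%R%:R) <=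
    2 * (lam ^+ 4 * M%:R / 4 + 2 * expR (- (del ^+ 2 * h))) +
    ((expR (lam ^+ 2 * z) - 1) +
     2 * expR ((2 + 4 * del) * h - z ^+ 2 / (2 * M%:R)) +
     expR ((1 + 2 * del) * h) / (H ^ r)%:R).
Proof.
move=> lam0 del01 z0 h ->.
have cI : #|{: {ffun 'I_r -> 'I_H}}| = (H ^ r)%N by rewrite card_ffun !card_ord.
have cI0 : (0 < #|{: {ffun 'I_r -> 'I_H}}|)%N by rewrite cI expn_gt0 H_gt0.
have := second_moment_bound (card_sign_arrays_gt0 N S) M_gt0 cI0 Df_chain
  (fun f => @corr_sign R N S r.+1 (sh f) s0) DfDf_chain lam0 del01 z0.
rewrite cI; apply: le_trans; apply: Ex_le => x.
have [Pl|_] := ltP; last by rewrite ler0n.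
rewrite (_ : [forall f, _] = true)//; apply/forallP => f.
apply: le_lt_trans Pl; apply: le_trans (ler_norm _) _.
exact: Phi_ge (sh_adm f).
Qed.

End lower_bound.

(** * Polynomial decay of the tails *)

Section tail_decay.
Variable R : realType.
Implicit Types (N S r : nat) (eps : R).

Definition psi r N : R := Num.sqrt (2 * N%:R * (r%:R * ln N%:R)).

Lemma psi_ge0 r N : 0 <= psi r N.
Proof. exact: sqrtr_ge0. Qed.

Lemma psi_sqr r N : (0 < N)%N -> psi r N ^+ 2 = 2 * N%:R * (r%:R * ln N%:R).
Proof.
by move=> N0; rewrite sqr_sqrtr// !mulr_ge0// ln_ge0// ler1n.
Qed.

Lemma expR_ln_nat N : (0 < N)%N -> expR (ln (N%:R : R)) = N%:R.
Proof. by move=> N0; rewrite lnK// posrE ltr0n. Qed.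

(** Of the margin eps, half goes to the grid windows, where (1 + eps/2)^2 >= 1 + eps beats the N^r
    choices of shifts, and half to the two short windows. *)
Lemma Phi_upper_decay S r eps : (0 < r)%N -> 0 < eps <= 1 ->
  exists eta C : R, exists N0 : nat, [/\ 0 < eta, 0 <= C & forall N, (N0 <= N)%N ->
    Ex (fun x : {ffun 'I_N * 'I_S -> bool} =>
      ((1 + eps) * psi r N < Phi (sg R x) N S r.+1)%R%:R) <= C * expR (- (eta * ln N%:R))].
Proof.
move=> r0 /andP[e0 e1].
(* Since N / h >= Q / 2, the short windows get the exponent (eps^2 / 16) (N / h) r ln N >= 3 r ln N.
   The three parts pay for the shifts, the end points and the decay. *)
pose Q := (Num.trunc (96 / eps ^+ 2)).+1.
have Qlt : 96 / eps ^+ 2 < Q%:R by rewrite /Q truncnS_gt.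
pose C : R := (S ^ r.+1)%:R * (2 * (Q.+1 * Q.+1)%:R + 4).
exists (eps * r%:R), C, Q.
split; [by rewrite mulr_gt0// ltr0n | by rewrite /C mulr_ge0// addr_ge0// mulr_ge0 |].
move=> N QN; have N0 : (0 < N)%N by apply: leq_trans QN.
set L := ln N%:R; have L0 : 0 <= L by rewrite ln_ge0// ler1n.
pose h := (N %/ Q).+1.
have Nlt : (N < Q.+1 * h)%N.
  rewrite mulnC (leq_trans (ltn_ceil N (ltn0Sn _ : 0 < Q)%N))//.
  by rewrite leq_mul2l leqnSn orbT.
pose t1 := (1 + eps / 2) * psi r N; pose t2 := eps / 4 * psi r N.
have t10 : 0 <= t1 by rewrite mulr_ge0 ?psi_ge0//; lra.
have t20 : 0 <= t2 by rewrite mulr_ge0 ?psi_ge0//; lra.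
have -> : (1 + eps) * psi r N = t1 + 2 * t2 by rewrite /t1 /t2; field.
have NR : 0 < (N%:R : R) by rewrite ltr0n.
have rL0 : 0 <= r%:R * L by rewrite mulr_ge0.
apply: le_trans (@Phi_upper_tail R N S r Q h N0 isT Nlt t1 t2 t10 t20) _.
have Nr : (N ^ r)%:R = expR (r%:R * L) by rewrite natrX expRM_natl expR_ln_nat.
have b1 : (N ^ r * S ^ r.+1 * (Q.+1 * Q.+1))%:R * (2 * expR (- (t1 ^+ 2 / (2 * N%:R)))) <=
    (S ^ r.+1)%:R * (2 * (Q.+1 * Q.+1)%:R) * expR (- (eps * r%:R * L)).
  rewrite 2!natrM Nr.
  have -> : expR (r%:R * L) * (S ^ r.+1)%:R * (Q.+1 * Q.+1)%:R * (2 * expR (- (t1 ^+ 2 / (2 * N%:R)))) =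
    (S ^ r.+1)%:R * (2 * (Q.+1 * Q.+1)%:R) * (expR (r%:R * L) * expR (- (t1 ^+ 2 / (2 * N%:R)))) by ring.
  rewrite ler_wpM2l ?mulr_ge0// -expRD ler_expR.
  have -> : t1 ^+ 2 / (2 * N%:R) = (1 + eps / 2) ^+ 2 * (r%:R * L).
    by rewrite /t1 exprMn psi_sqr// -/L; field; rewrite gt_eqF.
  have : 0 <= (eps / 2) ^+ 2 * (r%:R * L) by rewrite mulr_ge0// sqr_ge0.
  by lra.
have b2 : (N ^ r * S ^ r.+1 * N.+1)%:R * (2 * expR (- (t2 ^+ 2 / (2 * h%:R)))) <=
    (S ^ r.+1)%:R * 4 * expR (- (eps * r%:R * L)).
  rewrite 2!natrM Nr.
  have N1 : N.+1%:R <= 2 * expR L.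
    by rewrite expR_ln_nat// -natrM ler_nat mul2n -addnn -addn1 leq_add2l.
  apply: (@le_trans _ _ (expR (r%:R * L) * (S ^ r.+1)%:R * (2 * expR L) * (2 * expR (- (t2 ^+ 2 / (2 * h%:R)))))).
    by rewrite ler_wpM2r ?mulr_ge0 ?expR_ge0// ler_wpM2l ?mulr_ge0 ?expR_ge0.
  have -> : expR (r%:R * L) * (S ^ r.+1)%:R * (2 * expR L) * (2 * expR (- (t2 ^+ 2 / (2 * h%:R)))) =
    (S ^ r.+1)%:R * 4 * (expR (r%:R * L) * expR L * expR (- (t2 ^+ 2 / (2 * h%:R)))) by ring.
  rewrite ler_wpM2l ?mulr_ge0// -!expRD ler_expR.
  have hR : 0 < (h%:R : R) by rewrite ltr0n.
  have hle : h%:R * Q%:R <= 2 * N%:R :> R.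
    by rewrite -!natrM ler_nat /h mulSn mul2n -addnn leq_add// leq_trunc_div.
  have -> : t2 ^+ 2 / (2 * h%:R) = eps ^+ 2 / 16 * (N%:R / h%:R) * (r%:R * L).
    by rewrite /t2 exprMn psi_sqr// -/L; field; rewrite gt_eqF.
  have k3 : 3 <= eps ^+ 2 / 16 * (N%:R / h%:R).
    have e20 : 0 < eps ^+ 2 by rewrite exprn_gt0.
    have : Q%:R / 2 <= N%:R / h%:R :> R by rewrite ler_pdivlMr//; lra.
    move: Qlt; rewrite ltr_pdivrMr// => Ql Nh.
    have := ler_wpM2l (ltW e20) Nh; lra.
  have := ler_wpM2r rL0 k3.
  have : L <= r%:R * L by rewrite ler_peMl// ler1n.
  have : eps * (r%:R * L) <= r%:R * L by rewrite ler_piMl.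
  by rewrite -mulrA; lra.
by move: b1 b2; rewrite /C; lra.
Qed.

(** From (1 - u) exp u <= 1 and (1 + 2u) (1 - u) >= 1 on this interval. *)
Lemma expRB1_le (u : R) : 0 <= u <= 2^-1 -> expR u - 1 <= 2 * u.
Proof.
move=> /andP[u0 u1]; have := expR_ge1Dx (- u); rewrite expRN.
have := expR_gt0 u => e0; rewrite -(ler_pM2r e0) mulVf ?gt_eqF// => h.
have : (expR u - 1 - 2 * u) * (1 - u) <= 0.
  have : 0 <= u * (1 - 2 * u) by rewrite mulr_ge0//; lra.
  lra.
by rewrite pmulr_lle0; lra.
Qed.

End tail_decay.

(** * The five error terms of the second moment bound *)

Section lower_terms.
Variables (R : realType) (r L del n m lam : R).
(** One decay rate that serves all five terms. Here n = N, m = M, L = ln N, and [th] is the fraction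
    for which lam^2 M / 2 = th r L. *)
Let eta := del ^+ 2 / 8.
Let th := (1 - del) ^+ 2.
Hypotheses (r_ge1 : 1 <= r) (L_ge0 : 0 <= L) (nE : n = expR L).
Hypotheses (m_le : m <= n) (n_le : n <= 2 * m).
Hypotheses (del_gt0 : 0 < del) (del_le : del <= 3^-1).
Hypothesis lam2 : lam ^+ 2 = 2 * th * (r * L) / m.
Hypothesis L_large : 64 * r <= expR (L / 8).

Let n_gt0 : 0 < n. Proof. by rewrite nE expR_gt0. Qed.
Let m_gt0 : 0 < m. Proof. by move: n_gt0 n_le; lra. Qed.
Let r_ge0 : 0 <= r. Proof. exact: le_trans r_ge1. Qed.
Let rL0 : 0 <= r * L. Proof. exact: mulr_ge0. Qed.
Let LrL : L <= r * L. Proof. by rewrite ler_peMl. Qed.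
Let th0 : 0 <= th. Proof. exact: sqr_ge0. Qed.
Let th1 : th <= 1. Proof. by rewrite /th exprn_ile1//; move: del_gt0 del_le; lra. Qed.
Let th49 : 4 / 9 <= th. Proof. by rewrite /th; move: del_gt0 del_le; nra. Qed.
Let thrL : th * (r * L) <= r * L. Proof. by rewrite ler_piMl. Qed.
Let eta_le : eta <= 8^-1. Proof. by rewrite /eta; move: del_gt0 del_le; nra. Qed.

Let decay c : eta <= c -> expR (- (c * L)) <= expR (- (eta * L)).
Proof. by move=> ec; rewrite ler_expR lerN2 ler_wpM2r. Qed.

Let L4 : L <= 4 * expR (L / 4).
Proof. by have := expR_ge1Dx (L / 4); lra. Qed.

Let L8 : L <= 8 * expR (L / 8).
Proof. by have := expR_ge1Dx (L / 8); lra. Qed.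

Let lamM : lam ^+ 2 * m / 2 = th * (r * L).
Proof. by rewrite lam2; field; rewrite gt_eqF. Qed.

Let lam_le : lam ^+ 2 <= 4 * (r * L) * expR (- L).
Proof.
rewrite lam2 expRN -nE ler_pdivrMr// [leRHS]mulrAC ler_pdivlMr//.
have h1 := ler_wpM2r (ltW n_gt0) thrL; have h2 := ler_wpM2l rL0 n_le.
by move: h1 h2; lra.
Qed.

(** lam^2 is of order L / n, so the term is of order L^2 / n; the powers of L are absorbed by exp (L
    / 4). *)
Lemma lower_term1 : 2 * (lam ^+ 4 * m / 4) <= 64 * r ^+ 2 * expR (- (eta * L)).
Proof.
have -> : 2 * (lam ^+ 4 * m / 4) = lam ^+ 2 * (th * (r * L)).
  by rewrite -lamM; field.
apply: (@le_trans _ _ (4 * (r * L) * expR (- L) * (r * L))).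
  by apply: ler_pM => //; [exact: sqr_ge0|exact: mulr_ge0].
apply: (@le_trans _ _ (64 * r ^+ 2 * expR (- (2^-1 * L)))); last first.
  rewrite ler_wpM2l ?mulr_ge0 ?sqr_ge0// decay//.
  by move: eta_le; lra.
have -> : 4 * (r * L) * expR (- L) * (r * L) = 4 * r ^+ 2 * expR (- L) * (L * L) by ring.
have -> : expR (- (2^-1 * L)) = expR (- L) * (expR (L / 4) * expR (L / 4)).
  by rewrite -!expRD; congr expR; field.
have -> : 64 * r ^+ 2 * (expR (- L) * (expR (L / 4) * expR (L / 4))) =
  4 * r ^+ 2 * expR (- L) * ((4 * expR (L / 4)) * (4 * expR (L / 4))) by ring.
by apply: ler_wpM2l; [rewrite !mulr_ge0 ?expR_ge0|exact: ler_pM].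
Qed.

Lemma lower_term2 :
  2 * (2 * expR (- (del ^+ 2 * (th * (r * L))))) <= 4 * expR (- (eta * L)).
Proof.
have d20 : 0 <= del ^+ 2 by exact: sqr_ge0.
have : expR (- (del ^+ 2 * (th * (r * L)))) <= expR (- (eta * L)).
  rewrite ler_expR lerN2 /eta.
  have h1 : 4 / 9 * L <= th * (r * L) by apply: ler_pM => //; rewrite divr_ge0.
  have h2 := ler_wpM2l d20 h1; have h3 : 0 <= del ^+ 2 * L by rewrite mulr_ge0.
  by move: h2 h3; lra.
by lra.
Qed.

(** The choice z = n^(3/4) makes lam^2 z of order L n^(-1/4), hence at most 1/2 by [L_large]. *)
Lemma lower_term3 : expR (lam ^+ 2 * expR (3 / 4 * L)) - 1 <= 64 * r * expR (- (eta * L)).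
Proof.
set z := expR (3 / 4 * L); have z0 : 0 <= z := expR_ge0 _.
have ule : lam ^+ 2 * z <= 32 * r * expR (- (8^-1 * L)).
  apply: (@le_trans _ _ (4 * (r * L) * expR (- L) * z)); first by rewrite ler_wpM2r.
  have -> : expR (- (8^-1 * L)) = expR (- L) * z * expR (L / 8).
    by rewrite /z -!expRD; congr expR; field.
  have -> : 4 * (r * L) * expR (- L) * z = 4 * r * expR (- L) * z * L by ring.
  have -> : 32 * r * (expR (- L) * z * expR (L / 8)) = 4 * r * expR (- L) * z * (8 * expR (L / 8)) by ring.
  by rewrite ler_wpM2l// !mulr_ge0 ?expR_ge0.
have le1 : 64 * r * expR (- (8^-1 * L)) <= 1.
  by rewrite [8^-1 * L]mulrC expRN ler_pdivrMr ?expR_gt0// mul1r.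
have r640 : 0 <= 64 * r by rewrite mulr_ge0.
have h1 := ler_wpM2l r640 (decay eta_le).
have u1 : 0 <= lam ^+ 2 * z <= 2^-1.
  by rewrite mulr_ge0 ?sqr_ge0//=; move: ule le1; lra.
by have := expRB1_le u1; move: ule h1; lra.
Qed.

(** The same z is large enough: z^2 / (2 m) is at least n^(1/2) / 2, which outgrows every multiple
    of L. *)
Lemma lower_term4 :
  2 * expR ((2 + 4 * del) * (th * (r * L)) - expR (3 / 4 * L) ^+ 2 / (2 * m)) <=
    2 * expR (- (eta * L)).
Proof.
set z := expR (3 / 4 * L); rewrite ler_pM2l// ler_expR.
pose E := expR (L / 4) * expR (L / 4).
have z2 : E / 2 <= z ^+ 2 / (2 * m).
  rewrite ler_pdivlMr ?mulr_gt0//.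
  have -> : z ^+ 2 = E * n.
    by rewrite nE /z /E expr2 -!expRD; congr expR; field.
  have h := ler_wpM2l (mulr_ge0 (expR_ge0 (L / 4)) (expR_ge0 (L / 4))) m_le.
  by move: h; rewrite -/E; lra.
have big : 16 * (r * L) <= E.
  have h4 : L / 4 <= expR (L / 4) by move: L4; lra.
  have b4 : 64 * r <= expR (L / 4).
    by apply: (le_trans L_large); rewrite ler_expR; move: L_ge0; lra.
  have r640 : 0 <= 64 * r by rewrite mulr_ge0.
  have L40 : 0 <= L / 4 by rewrite divr_ge0.
  by have := ler_pM r640 L40 b4 h4; rewrite -/E; lra.
have h2 : (2 + 4 * del) * (th * (r * L)) <= 4 * (r * L).
  apply: ler_pM => //; first by move: del_gt0; lra.
    exact: mulr_ge0.
  by move: del_le; lra.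
have h4 : eta * L <= 8^-1 * L by rewrite ler_wpM2r.
by move: z2 big h2 h4 LrL L_ge0; lra.
Qed.

(** (1 + 2 del) (1 - del)^2 <= 1 - del^2, so the diagonal term stays below the number of sets of
    shifts, of order n^r. *)
Lemma lower_term5_exp : (1 + 2 * del) * (th * (r * L)) <= r * L - eta * L.
Proof.
have h5 : (1 + 2 * del) * th <= 1 - del ^+ 2.
  have : 0 <= del ^+ 2 * (1 - del).
    by rewrite mulr_ge0 ?sqr_ge0//; move: del_le; lra.
  by rewrite /th; lra.
have h6 := ler_wpM2r rL0 h5; have h7 := ler_wpM2l (sqr_ge0 del) LrL.
have h8 : 0 <= del ^+ 2 * L by rewrite mulr_ge0 ?sqr_ge0.
by move: h6 h7 h8; rewrite /eta; lra.
Qed.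

End lower_terms.

(** * Decay of the lower tail *)

Section lower_decay.
Variable R : realType.
Implicit Types (N S r : nat) (eps : R).

(** Three factors 1 - del are lost: in the window, in the choice of lam, and in passing from N to M.
    Their product is at least 1 - 3 del. *)
Lemma psi_lower r N (M : nat) (del : R) : 0 <= del <= 1 -> (0 < N)%N -> (0 < M)%N ->
  (1 - del) * N%:R <= M%:R ->
  (1 - 3 * del) * psi R r N <=
  (1 - del) * (Num.sqrt (2 * (1 - del) ^+ 2 * (r%:R * ln N%:R) / M%:R) * M%:R).
Proof.
move=> /andP[d0 d1] N0 M0 MN; set L := ln N%:R.
have MR : 0 < (M%:R : R) by rewrite ltr0n.
have d1' : 0 <= 1 - del by rewrite subr_ge0.
have rL0 : 0 <= r%:R * L by rewrite mulr_ge0// ln_ge0// ler1n.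
have A0 : 0 <= 2 * (r%:R * L) * M%:R by rewrite mulr_ge0// mulr_ge0.
have -> : Num.sqrt (2 * (1 - del) ^+ 2 * (r%:R * L) / M%:R) * M%:R =
    (1 - del) * Num.sqrt (2 * (r%:R * L) * M%:R).
  apply/eqP; rewrite -(@eqrXn2 _ 2)// ?mulr_ge0 ?sqrtr_ge0//.
  rewrite exprMn sqr_sqrtr; last by rewrite divr_ge0// mulr_ge0// mulr_ge0// sqr_ge0.
  rewrite exprMn sqr_sqrtr//; apply/eqP; field.
  by rewrite gt_eqF.
have : (1 - del) * psi R r N <= Num.sqrt (2 * (r%:R * L) * M%:R).
  rewrite -(@ler_pXn2r _ 2)// ?nnegrE ?mulr_ge0 ?psi_ge0 ?sqrtr_ge0//.
  rewrite exprMn psi_sqr// sqr_sqrtr// -/L.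
  have -> : (1 - del) ^+ 2 * (2 * N%:R * (r%:R * L)) = 2 * (r%:R * L) * ((1 - del) * ((1 - del) * N%:R)) by ring.
  apply: ler_wpM2l; first exact: mulr_ge0.
  by apply: le_trans MN; rewrite ler_piMl ?mulr_ge0// gerBl.
set P := psi R r N; have P0 : 0 <= P := psi_ge0 R r N.
move=> h1; rewrite mulrA.
apply: (@le_trans _ _ ((1 - del) * (1 - del) * ((1 - del) * P))); last first.
  by rewrite ler_wpM2l// -expr2 sqr_ge0.
rewrite mulrA ler_wpM2r//.
have : 0 <= del ^+ 2 * (3 - del) by rewrite mulr_ge0 ?sqr_ge0//; move: d1; clear; lra.
by clear; lra.
Qed.

Lemma ln_nat_large (a N : nat) : (0 < a)%N -> (a ^ 8 <= N)%N ->
  a%:R <= expR (ln N%:R / 8) :> R.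
Proof.
move=> a0 aN; have aR : 0 < (a%:R : R) by rewrite ltr0n.
rewrite -[leLHS](expR_ln_nat R a0) ler_expR ler_pdivlMr//.
rewrite -[8]/(8%:R) mulr_natr -lnXn// ler_ln ?posrE ?exprn_gt0//; last first.
  by rewrite ltr0n (leq_trans _ aN)// expn_gt0 a0.
by rewrite -natrX ler_nat.
Qed.

Lemma Phi_lower_decay S' r eps : (0 < r)%N -> 0 < eps < 1 ->
  exists eta C : R, exists N0 : nat, [/\ 0 < eta, 0 <= C & forall N, (N0 <= N)%N ->
    Ex (fun x : {ffun 'I_N * 'I_S'.+1 -> bool} =>
      (Phi (sg R x) N S'.+1 r.+1 < (1 - eps) * psi R r N)%R%:R) <= C * expR (- (eta * ln N%:R))].
Proof.
move=> r0 /andP[e0 e1].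
pose del : R := eps / 3; have d0 : 0 < del by rewrite divr_gt0.
have d3 : del <= 3^-1 by move: e1; rewrite /del; clear; lra.
have d1 : del < 1 by apply: (le_lt_trans d3); rewrite invf_lt1// ltr1n.
(* With blocks of length H = N / Q, the r blocks of shifts take up at most del N positions, leaving
   M >= (1 - del) N. *)
have [Q Q0 Qlt] : exists2 Q, (0 < Q)%N & r%:R / del < Q%:R.
  by exists (Num.trunc (r%:R / del)).+1; rewrite ?truncnS_gt.
pose eta : R := del ^+ 2 / 8.
pose C : R := 64 * r%:R ^+ 2 + 4 + 64 * r%:R + 2 + (2 * Q%:R) ^+ r.
(* The first threshold makes the blocks nonempty, the second gives 64 r <= N^(1/8). *)
exists eta, C, (maxn (2 * Q) ((64 * r) ^ 8)); split.
- by rewrite divr_gt0// exprn_gt0.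
- by rewrite /C !addr_ge0 ?mulr_ge0 ?exprn_ge0 ?mulr_ge0.
move=> N; rewrite geq_max => /andP[QN rN].
have big8 : 64 * r%:R <= expR (ln N%:R / 8) :> R.
  by rewrite -natrM ln_nat_large// muln_gt0.
have N0 : (0 < N)%N by rewrite (leq_trans _ QN)// muln_gt0.
have QleN : (Q <= N)%N by rewrite (leq_trans _ QN)// leq_pmull.
clear rN QN.
have NR : 0 < (N%:R : R) by rewrite ltr0n.
set L := ln N%:R; have L0 : 0 <= L by rewrite ln_ge0// ler1n.
have r1 : 1 <= (r%:R : R) by rewrite ler1n.
pose H := (N %/ Q)%N.
have H0 : (0 < H)%N by rewrite divn_gt0.
have HQ : H%:R * Q%:R <= (N%:R : R) by rewrite -natrM ler_nat leq_trunc_div.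
have HQ' : N%:R <= 2 * (H%:R * Q%:R) :> R.
  rewrite -!natrM ler_nat {1}(divn_eq N Q) mul2n -addnn leq_add2l.
  by rewrite (leq_trans (ltnW (ltn_pmod N _)))// leq_pmull.
have rH : r%:R * H%:R <= del * N%:R.
  move: Qlt; rewrite ltr_pdivrMr// => Ql.
  apply: (@le_trans _ _ (del * (H%:R * Q%:R))); last by rewrite ler_wpM2l// ltW.
  by have := ler_wpM2r (ler0n R H) (ltW Ql); clear; lra.
have rHN : (r * H <= N)%N.
  by rewrite -(ler_nat R) natrM (le_trans rH)// ler_piMl// ltW.
have [M ME] : exists M, M = (N - r * H)%N by exists (N - r * H)%N.
have MH : (M + r * H <= N)%N by rewrite ME subnK.
have MNle : M%:R <= N%:R :> R by rewrite ler_nat ME leq_subr.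
have {}ME : M%:R = N%:R - r%:R * H%:R :> R by rewrite ME natrB// natrM.
have MN : (1 - del) * N%:R <= M%:R by move: rH; rewrite ME; clear; lra.
have M2 : N%:R <= 2 * M%:R :> R.
  have := ler_wpM2r (ltW NR) d3; move: MN NR; clear; lra.
have M0 : (0 < M)%N by rewrite -(ltr0n R); move: M2 NR; clear; lra.
pose lam := Num.sqrt (2 * (1 - del) ^+ 2 * (r%:R * L) / M%:R).
have lam2 : lam ^+ 2 = 2 * (1 - del) ^+ 2 * (r%:R * L) / M%:R.
  have rL0 : 0 <= r%:R * L by rewrite mulr_ge0.
  by rewrite sqr_sqrtr// divr_ge0// mulr_ge0// mulr_ge0// sqr_ge0.
have hE : (1 - del) ^+ 2 * (r%:R * L) = lam ^+ 2 * M%:R / 2.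
  by rewrite lam2; field; rewrite pnatr_eq0 -lt0n.
have low : (1 - eps) * psi R r N <= (1 - del) * (lam * M%:R).
  have -> : eps = 3 * del by rewrite /del; field.
  by apply: psi_lower; rewrite ?(ltW d0) ?(ltW d1).
apply: (@le_trans _ _ (Ex (fun x : {ffun 'I_N * 'I_S'.+1 -> bool} =>
    (Phi (sg R x) N S'.+1 r.+1 < (1 - del) * (lam * M%:R))%R%:R))).
  apply: Ex_le => x; have [lt|_] := ltP; last by [].
  by rewrite (lt_le_trans lt low).
have d01 : 0 < del < 1 by rewrite d0.
apply: le_trans (Phi_lower_tail S' M0 H0 MH (sqrtr_ge0 _) d01 (expR_ge0 (3 / 4 * L)) hE) _.
have eL : N%:R = expR L :> R by rewrite expR_ln_nat.
have T1 := lower_term1 r1 L0 eL M2 d0 d3 lam2.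
have T2 := lower_term2 r1 L0 d0 d3.
have T3 := lower_term3 r1 L0 eL M2 d0 d3 lam2 big8.
have T4 := lower_term4 r1 L0 eL MNle M2 d0 d3 big8.
have T5 : expR ((1 + 2 * del) * ((1 - del) ^+ 2 * (r%:R * L))) / (H ^ r)%:R <=
    (2 * Q%:R) ^+ r * expR (- (eta * L)).
  rewrite natrX ler_pdivrMr ?exprn_gt0 ?ltr0n// [leRHS]mulrAC -exprMn.
  apply: (@le_trans _ _ (N%:R ^+ r * expR (- (eta * L)))); last first.
    rewrite ler_wpM2r ?expR_ge0// lerXn2r ?nnegrE ?mulr_ge0//.
    by apply: (le_trans HQ'); rewrite -mulrA [Q%:R * _]mulrC.
  rewrite eL -expRM_natl -expRD ler_expR.
  exact: lower_term5_exp.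
rewrite mulrDr.
have -> : C * expR (- (eta * L)) =
    (64 * r%:R ^+ 2 * expR (- (eta * L)) + 4 * expR (- (eta * L))) +
    (64 * r%:R * expR (- (eta * L)) + 2 * expR (- (eta * L)) +
     (2 * Q%:R) ^+ r * expR (- (eta * L))).
  by rewrite /C; move: (expR _) ((2 * Q%:R) ^+ r) => u v; ring.
apply: lerD; first exact: lerD T1 T2.
exact: lerD (lerD T3 T4) T5.
Qed.

End lower_decay.

(** * Almost sure convergence *)

Section transfer.
Variables (R : realType) (d : measure_display) (T : measurableType d).
Variables (P : probability T R) (S : nat) (e : nat -> nat -> T -> R).
Hypothesis e_meas : forall n s, (0 < n)%N -> (0 < s <= S)%N -> measurable_fun setT (e n s).
Hypothesis e_sign : forall n s w, (0 < n)%N -> (0 < s <= S)%N -> e n s w = 1 \/ e n s w = -1.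
Hypothesis e_cyl : forall (N : nat) (a : 'I_N -> 'I_S -> bool),
  P [set w | forall (n : 'I_N) (s : 'I_S), e (n.+1) (s.+1) w = pm1 (a n s)]
    = ((2 ^- (N * S))%:E)%E.

(** [U] is the finite union of the cylinders over the bad arrays, which settles measurability;
    outside it, the array read off from [w] is good. *)
Lemma finite_transfer (N : nat) (B : pred {ffun 'I_N * 'I_S -> bool}) (p : R) :
  Ex (fun x => (B x)%:R) <= p ->
  exists U, [/\ measurable U, (P U <= p%:E)%E &
    forall w, ~ U w -> exists x, ~~ B x /\
      forall n s, (n < N)%N -> (s < S)%N -> e n.+1 s.+1 w = sg R x n.+1 s.+1].
Proof.
move=> Bp.
pose cyl (x : {ffun 'I_N * 'I_S -> bool}) :=
  [set w | forall (n : 'I_N) (s : 'I_S), e (n.+1) (s.+1) w = pm1 (x (n, s))].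
have cyl_meas x : measurable (cyl x).
  have -> : cyl x = \bigcap_(c in [set: 'I_N * 'I_S]) (e c.1.+1 c.2.+1 @^-1` [set pm1 (x c)]).
    apply/seteqP; split=> [w h [n s] _ /=|w h n s]; first exact: h.
    exact: (h (n, s) I).
  apply: fin_bigcap_measurable => [|c _]; first exact: finite_finset.
  by rewrite -[X in measurable X]setTI; apply: e_meas => //; rewrite ltn_ord.
exists (\big[setU/set0]_(x | B x) cyl x); split.
- by apply: bigsetU_measurable => x _.
- apply: (@le_trans _ _ (\sum_(x | B x) P (cyl x))%E).
    elim: (index_enum _) => [|x l IH]; first by rewrite !big_nil measure0.
    rewrite !big_cons; case: (B x) => //.
    apply: (le_trans (measureU2 _ _ _)) => //; first exact: bigsetU_measurable.
    exact: leeD2l.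
  under eq_bigr do rewrite /cyl (e_cyl (fun n s => _ (n, s))).
  rewrite sumEFin lee_fin; apply: le_trans Bp.
  rewrite /Ex card_ffun card_prod !card_ord card_bool natrX mulr_suml big_mkcond/=.
  by apply: ler_sum => x _; case: (B x); rewrite ?mul1r ?mul0r.
move=> w nU.
pose x : {ffun 'I_N * 'I_S -> bool} := [ffun c : 'I_N * 'I_S => e c.1.+1 c.2.+1 w == 1].
have wx : cyl x w.
  move=> n s; rewrite ffunE/=.
  have [->|->] := @e_sign n.+1 s.+1 w isT (ltn_ord s); first by rewrite eqxx.
  by rewrite /pm1 ifN// eq_sym -subr_eq0 opprK -[1 + 1]/(2%:R) pnatr_eq0.
exists x; split.
  by apply/negP => Bx; apply: nU; rewrite (bigD1 x)//=; left.
move=> n s nN sS; have := wx (Ordinal nN) (Ordinal sS); rewrite /= => ->.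
by rewrite -[n]/(val (Ordinal nN)) -[s]/(val (Ordinal sS)) sgE.
Qed.

End transfer.

(** Borel-Cantelli, with summability from 1/(n+2)^2 <= 1/(n+1) - 1/(n+2). *)
Lemma ae_eventually_notin (R : realType) (d : measure_display) (T : measurableType d)
  (P : probability T R) (U : nat -> set T) (C : R) (j0 : nat) :
  0 <= C -> (forall j, (j0 <= j)%N -> measurable (U j)) ->
  (forall j, (j0 <= j)%N -> (P (U j) <= (C / j%:R ^+ 2)%:E)%E) ->
  {ae P, forall w, exists n, forall j, (n <= j)%N -> ~ U j w}.
Proof.
(* The shift by j0 enters the range of the hypotheses; the extra 2 makes the sum telescope from
   1. *)
move=> C0 Um Ub; pose F j := U (j0 + j.+2)%N.
have Fm j : measurable (F j) by apply: Um; rewrite leq_addr.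
have partial n : \sum_(i < n) C / (i.+2)%:R ^+ 2 <= C * (1 - (n.+1)%:R^-1) :> R.
  elim: n => [|n IH]; first by rewrite big_ord0 invr1 subrr mulr0.
  rewrite big_ord_recr/=; apply: (le_trans (lerD IH (lexx _))).
  rewrite -mulrDr ler_wpM2l//.
  have n1 : 0 < (n.+1%:R : R) by rewrite ltr0n.
  have n2 : n.+2%:R = n.+1%:R + 1 :> R by rewrite -natr1.
  rewrite -subr_ge0 n2; move: n1; set a := n.+1%:R => a0.
  have -> : 1 - (a + 1)^-1 - (1 - a^-1 + ((a + 1) ^+ 2)^-1) = (a * (a + 1) ^+ 2)^-1.
    by field; rewrite !gt_eqF// addr_gt0.
  by rewrite invr_ge0 mulr_ge0 ?sqr_ge0// ltW.
have lim0 : P (lim_sup_set F) = 0%E.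
  apply: lim_sup_set_cvg0 => //.
  apply: (@le_lt_trans _ _ C%:E); last by rewrite ltry.
  apply: lime_le; first by apply: is_cvg_nneseries.
  near=> n; rewrite big_mkord.
  apply: (@le_trans _ _ (\sum_(i < n) (C / (i.+2)%:R ^+ 2)%:E)%E).
    apply: lee_sum => i _; apply: le_trans (Ub _ (leq_addr _ _)) _.
    rewrite lee_fin ler_wpM2l// lef_pV2 ?posrE ?exprn_gt0 ?ltr0n ?addnS//.
    by rewrite lerXn2r ?nnegrE// ler_nat; lia.
  rewrite sumEFin lee_fin; apply: (le_trans (partial n)).
  by rewrite ler_piMr// gerBl invr_ge0.
exists (lim_sup_set F); split => //.
  apply: bigcapT_measurable => n; apply: bigcup_measurable => k _; exact: Fm.
move=> w /= nE; apply: contrapT => nl; apply: nE.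
have [n nn] : exists n, forall j, (n <= j)%N -> ~ F j w.
  apply: contrapT => h; apply: nl => n _ /=.
  apply: contrapT => h'; apply: h; exists n => j nj Fj; apply: h'.
  by exists j.
exists (j0 + n.+2)%N => j jn; have -> : j = (j0 + (j - j0 - 2).+2)%N by lia.
by apply: nn; lia.
Unshelve. all: end_near. Qed.

(** * Comparison of normalisations and interpolation between powers *)

Section normalisation.
Variable R : realType.
Implicit Types (N r q j : nat) (eps : R).

Lemma psi_le r N N' : (0 < N)%N -> (N <= N')%N -> psi R r N <= psi R r N'.
Proof.
move=> N0 NN; rewrite ler_sqrt; last first.
  by rewrite !mulr_ge0// ln_ge0// ler1n (leq_trans N0).
have lN : 0 <= ln (N%:R : R) by rewrite ln_ge0// ler1n.
apply: ler_pM; rewrite ?mulr_ge0 ?ler_wpM2l ?ler_nat//.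
by rewrite ler_ln ?posrE ?ltr0n ?ler_nat// (leq_trans N0).
Qed.

(** With x = 1 + 1/j, the squared ratio is at most x^(q+1): x^q comes from the powers, and ln (j+1)
    <= x ln j once ln j >= 1. *)
Lemma psi_ratio r q eps : 0 < eps ->
  exists j0, forall j, (j0 <= j)%N -> psi R r (j.+1 ^ q) <= (1 + eps) * psi R r (j ^ q).
Proof.
(* The thresholds give ln j >= 1, (q+1)/j <= 1/2 and 2 (q+1)/j <= eps, in this order. *)
move=> e0; exists (maxn 4 (maxn (2 * q.+1) (Num.trunc (2 * q.+1%:R / eps)).+1)) => j.
rewrite !geq_max => /and3P[j4 jq je].
have j0 : (0 < j)%N by apply: leq_trans j4.
have jR : 0 < (j%:R : R) by rewrite ltr0n.
have lj1 : 1 <= ln (j%:R : R).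
  rewrite -ler_expR expR_ln_nat//; apply: (@le_trans _ _ 4); last by rewrite ler_nat.
  have : 2^-1 <= expR (- 2^-1 : R) by have := expR_ge1Dx (- 2^-1 : R); lra.
  rewrite expRN lef_pV2 ?posrE ?expR_gt0// => h.
  have -> : expR 1 = expR 2^-1 * expR 2^-1 :> R.
    by rewrite -expRD; congr expR; field.
  have -> : 4 = 2 * 2 :> R by ring.
  by rewrite ler_pM ?expR_ge0.
have lj0 : 0 <= ln (j%:R : R) by apply: le_trans lj1.
pose x : R := 1 + j%:R^-1.
have x0 : 0 <= x by rewrite addr_ge0// invr_ge0.
have jx : j.+1%:R = j%:R * x by rewrite /x mulrDr mulr1 mulfV ?gt_eqF// natr1.
have lx : ln (j.+1%:R : R) <= ln j%:R * x.
  have xp : 0 < x by rewrite ltr_pwDl// invr_ge0.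
  rewrite jx lnM ?posrE// /x mulrDr mulr1 lerD2l.
  apply: le_trans (le_ln1Dx _) _; first by rewrite (lt_le_trans (ltrN10 _))// invr_ge0.
  by rewrite ler_peMl ?invr_ge0.
have xq : x ^+ q.+1 <= 1 + eps.
  apply: (@le_trans _ _ (expR (q.+1%:R / j%:R))).
    by rewrite expRM_natl lerXn2r ?nnegrE ?expR_ge0// expR_ge1Dx.
  have u1 : 0 <= (q.+1%:R / j%:R : R) <= 2^-1.
    by rewrite divr_ge0//= ler_pdivrMr// mulrC ler_pdivlMr// -natrM ler_nat mulnC.
  have := expRB1_le u1.
  have : 2 * (q.+1%:R / j%:R) <= eps.
    have jt : 2 * q.+1%:R / eps < j%:R by apply: lt_le_trans (truncnS_gt _) _; rewrite ler_nat.
    by rewrite mulrA ler_pdivrMr// [leRHS]mulrC -ler_pdivrMr// ltW.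
  lra.
rewrite -(@ler_pXn2r _ 2)// ?nnegrE ?mulr_ge0 ?psi_ge0//; last by lra.
rewrite exprMn !psi_sqr ?expn_gt0 ?j0// !natrX !lnXn ?ltr0n//.
rewrite -(mulr_natr (ln j.+1%:R)) -(mulr_natr (ln j%:R)).
apply: (@le_trans _ _ (2 * (j%:R * x) ^+ q * (r%:R * (ln j%:R * x * q%:R)))).
  rewrite -jx; apply: ler_wpM2l; first by rewrite mulr_ge0// exprn_ge0.
  by apply: ler_wpM2l => //; apply: ler_wpM2r.
have -> : 2 * (j%:R * x) ^+ q * (r%:R * (ln j%:R * x * q%:R)) =
   x ^+ q.+1 * (2 * j%:R ^+ q * (r%:R * (ln j%:R * q%:R))).
  by rewrite exprMn exprS; ring.
apply: ler_wpM2r; first by rewrite mulr_ge0 // ?mulr_ge0 // ?exprn_ge0 // mulr_ge0.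
apply: (le_trans xq).
by rewrite expr2 ler_peMl; lra.
Qed.

Definition binpsi r N : R := Num.sqrt (2 * N%:R * ln 'C(N, r)%:R).

Lemma ffact_bounds n m : ((n - m) ^ m <= n ^_ m <= n ^ m)%N.
Proof.
elim: m => [|m /andP[lo hi]]; first by rewrite ffactn0 !expn0.
rewrite ffactnSr !expnSr; apply/andP; split; apply: leq_mul.
- apply: leq_trans lo; case: (m) => // p.
  by rewrite leq_exp2r// leq_sub2l.
- by rewrite leq_sub2l.
- exact: hi.
- exact: leq_subr.
Qed.

(** (N / (2r))^r <= 'C(N, r) <= N^r, so ln 'C(N, r) differs from r ln N by at most r ln (2r), which
    is at most eps r ln N for large N. *)
Lemma binpsi_bounds r eps : (0 < r)%N -> 0 < eps < 1 ->
  exists N0, forall N, (N0 <= N)%N ->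
    [/\ (1 - eps) * psi R r N <= binpsi r N, binpsi r N <= psi R r N & 0 < psi R r N].
Proof.
move=> r0 /andP[e0 e1].
(* The second successor forces N > 1, hence ln N > 0. *)
exists (maxn (2 * r) (Num.trunc (expR (ln (2 * r)%:R / eps))).+2) => N.
rewrite geq_max => /andP[rN eN].
have N1 : (1 < N)%N by apply: leq_trans eN.
have N0 : (0 < N)%N by apply: ltnW.
have NR : 0 < (N%:R : R) by rewrite ltr0n.
have r2 : (0 < 2 * r)%N by rewrite muln_gt0.
have lN : 0 < ln (N%:R : R) by rewrite ln_gt0// ltr1n.
have rleN : (r <= N)%N by apply: leq_trans rN; rewrite leq_pmull.
have C0 : (0 < 'C(N, r))%N by rewrite bin_gt0.
have lnr : ln (2 * r)%:R <= eps * ln N%:R :> R.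
  rewrite mulrC -ler_pdivrMr// -ler_expR expR_ln_nat//.
  apply: (le_trans (ltW (truncnS_gt _))); rewrite ler_nat; exact: ltnW.
have /andP[flo fhi] := ffact_bounds N r.
have Chi : ('C(N, r) <= N ^ r)%N.
  by apply: leq_trans fhi; rewrite -bin_ffact leq_pmulr// fact_gt0.
have Clo : (N ^ r <= 'C(N, r) * (2 * r) ^ r)%N.
  have rr : (r`! <= r ^ r)%N.
    by have /andP[_] := ffact_bounds r r; rewrite ffactnn.
  have NN : (N ^ r <= (2 * (N - r)) ^ r)%N.
    by rewrite leq_exp2r//; move: rN; clear; lia.
  apply: (leq_trans NN); rewrite !expnMn mulnCA leq_mul2l; apply/orP; right.
  by apply: (leq_trans flo); rewrite -bin_ffact leq_mul2l rr orbT.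
have lnlo : (1 - eps) * (r%:R * ln N%:R) <= ln 'C(N, r)%:R :> R.
  have : ln (N ^ r)%:R <= ln ('C(N, r) * (2 * r) ^ r)%:R :> R.
    by rewrite ler_ln ?posrE ?ltr0n ?muln_gt0 ?expn_gt0 ?N0 ?r2 ?C0 ?ler_nat.
  rewrite natrM lnM ?posrE ?ltr0n ?expn_gt0 ?r2// !natrX !lnXn ?ltr0n//.
  rewrite -[X in _ <= _ + X]mulr_natl -[X in X <= _]mulr_natl.
  have := ler_wpM2l (ler0n R r) lnr; lra.
have lnhi : ln 'C(N, r)%:R <= r%:R * ln N%:R :> R.
  by rewrite mulr_natl -lnXn// -natrX ler_ln ?posrE ?ltr0n ?expn_gt0 ?N0// ler_nat.
have P0 : 0 < psi R r N by rewrite sqrtr_gt0 !mulr_gt0// ltr0n.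
split=> //; last first.
  by rewrite /binpsi /psi ler_sqrt ?ler_wpM2l ?mulr_ge0// ltW.
have l0 : 0 <= ln 'C(N, r)%:R :> R by rewrite ln_ge0// ler1n.
rewrite -(@ler_pXn2r _ 2)// ?nnegrE ?mulr_ge0 ?sqrtr_ge0//; last by lra.
rewrite exprMn psi_sqr// sqr_sqrtr ?mulr_ge0//.
have -> : (1 - eps) ^+ 2 * (2 * N%:R * (r%:R * ln N%:R)) =
  2 * N%:R * ((1 - eps) * ((1 - eps) * (r%:R * ln N%:R))) by ring.
rewrite ler_wpM2l ?mulr_ge0//; apply: le_trans lnlo.
rewrite ler_piMl ?mulr_ge0 ?(ltW lN)//; last by lra.
by lra.
Qed.

Lemma exp_bracket q (j1 N : nat) : (0 < q)%N -> (j1 ^ q <= N)%N ->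
  exists2 j, (j1 <= j)%N & (j ^ q <= N < j.+1 ^ q)%N.
Proof.
move=> q0 jN.
have bd j : (j ^ q <= N)%N -> (j <= N)%N.
  by apply: leq_trans; case: j => // j; rewrite -[leqLHS]expn1 leq_pexp2l.
have ex : exists j, (j ^ q <= N)%N by exists j1.
case: (ex_maxnP ex bd) => j jle jmax; exists j; first exact: jmax.
rewrite jle ltnNge; apply/negP => /jmax; by rewrite ltnn.
Qed.

(* psi varies slowly along j^q, so that monotonicity fills the gaps. *)
Lemma sandwich (f : nat -> R) r q eps :
  (forall N N', (N <= N')%N -> f N <= f N') -> (0 < r)%N -> (0 < q)%N ->
  0 < eps <= 2^-1 ->
  (exists j0, forall j, (j0 <= j)%N ->
     (1 - eps) * psi R r (j ^ q) <= f (j ^ q)%N <= (1 + eps) * psi R r (j ^ q)) ->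
  exists N0, forall N, (N0 <= N)%N -> `|1 - f N / binpsi r N| <= 7 * eps.
Proof.
move=> fmono r0 q0 /andP[e0 e1] [j0 jf].
have [j1 jr] := psi_ratio r q e0.
have e01 : 0 < eps < 1 by rewrite e0; lra.
have [N0 Nb] := binpsi_bounds r0 e01.
pose j2 := maxn 1 (maxn j0 j1).
exists (maxn N0 (j2 ^ q)) => N; rewrite geq_max => /andP[NN0 j2N].
have [j j2j /andP[jN Nj]] := exp_bracket q0 j2N.
move: j2j; rewrite !geq_max => /and3P[j1' j0j j1j].
have [lo hi P0] := Nb N NN0.
have /andP[fj _] := jf j j0j.
have /andP[_ fj1] := jf j.+1 (leqW j0j).
have pr := jr j j1j.
have jq0 : (0 < j ^ q)%N by rewrite expn_gt0 j1'.
have N1 : (0 < N)%N by apply: leq_trans jN.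
have p1 := psi_le r jq0 jN; have p2 := psi_le r N1 (ltnW Nj).
have f1 := fmono _ _ jN; have f2 := fmono _ _ (ltnW Nj).
move: fj fj1 pr p1 p2 f1 f2 lo hi P0.
set a := psi R r (j ^ q); set b := psi R r (j.+1 ^ q); set p := psi R r N.
set B := binpsi r N; set g := f N; set g1 := f (j ^ q)%N; set g2 := f (j.+1 ^ q)%N.
move=> fj fj1 pr p1 p2 f1 f2 lo hi P0.
have B0 : 0 < B by apply: lt_le_trans lo; rewrite mulr_gt0//; lra.
(* The 7 comes from (1 + eps)^2 <= (1 + 7 eps) (1 - eps), valid for eps <= 1/2. *)
have up : g <= (1 + 7 * eps) * B.
  have h1 : (1 + eps) * b <= (1 + eps) * ((1 + eps) * a) by rewrite ler_wpM2l//; lra.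
  have h2 : (1 + eps) * ((1 + eps) * a) <= (1 + eps) * ((1 + eps) * p).
    by rewrite ler_wpM2l ?ler_wpM2l//; lra.
  have h3 : (1 + 7 * eps) * ((1 - eps) * p) <= (1 + 7 * eps) * B by rewrite ler_wpM2l//; lra.
  have h4 : (1 + eps) * ((1 + eps) * p) <= (1 + 7 * eps) * ((1 - eps) * p).
    rewrite !mulrA ler_wpM2r ?(ltW P0)//.
    have : 0 <= eps * (2^-1 - eps) by rewrite mulr_ge0//; lra.
    lra.
  lra.
have dn : (1 - 7 * eps) * B <= g.
  have a0 : 0 <= a by exact: psi_ge0.
  have h1 : (1 - eps) * ((1 - eps) * p) <= (1 - eps) * a.
    rewrite ler_wpM2l//; first by lra.
    have h2 : (1 - eps) * p <= (1 - eps) * ((1 + eps) * a) by rewrite ler_wpM2l//; lra.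
    apply: (le_trans h2).
    have : 0 <= eps ^+ 2 * a by rewrite mulr_ge0 ?sqr_ge0.
    lra.
  have h2 : (1 - eps) * ((1 - eps) * B) <= (1 - eps) * ((1 - eps) * p).
    by rewrite ler_wpM2l ?ler_wpM2l//; lra.
  have h3 : 0 <= eps ^+ 2 * B by rewrite mulr_ge0 ?sqr_ge0// ltW.
  have h4 : 0 <= eps * B by rewrite mulr_ge0// ltW.
  lra.
have -> : 1 - g / B = (B - g) / B by field; rewrite gt_eqF.
rewrite normrM normfV (gtr0_norm B0) ler_pdivrMr// ler_norml.
by apply/andP; split; lra.
Qed.

End normalisation.

(** Both tails are O(N^-eta); with eta q >= 2 the failure probabilities along N = j^q are O(j^-2),
    and interpolation covers the remaining N. *)
Lemma ae_ratio_close (R : realType) (d : measure_display) (T : measurableType d)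
  (P : probability T R) (S r : nat) (e : nat -> nat -> T -> R) (eps : R) :
  (0 < S)%N ->
  (forall n s, (0 < n)%N -> (0 < s <= S)%N -> measurable_fun setT (e n s)) ->
  (forall n s w, (0 < n)%N -> (0 < s <= S)%N -> e n s w = 1 \/ e n s w = -1) ->
  (forall (N : nat) (a : 'I_N -> 'I_S -> bool),
     P [set w | forall (n : 'I_N) (s : 'I_S), e (n.+1) (s.+1) w = pm1 (a n s)]
       = ((2 ^- (N * S))%:E)%E) ->
  (0 < r)%N -> 0 < eps <= 2^-1 ->
  {ae P, forall w, exists N0, forall N, (N0 <= N)%N ->
    `|1 - Phi (fun n s => e n s w) N S r.+1 / binpsi R r N| <= 7 * eps}.
Proof.
case: S => // S' _ e_meas e_sign e_cyl r0 eps_bd.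
have [e0 e1] := andP eps_bd.
have e01 : 0 < eps <= 1 by rewrite e0; lra.
have e01' : 0 < eps < 1 by rewrite e0; lra.
have [eta1 [C1 [N1 [eta10 C10 H1]]]] := Phi_upper_decay S'.+1 r0 e01.
have [eta2 [C2 [N2 [eta20 C20 H2]]]] := Phi_lower_decay S' r0 e01'.
pose eta := Num.min eta1 eta2.
have eta0 : 0 < eta by rewrite lt_min eta10.
pose q := (Num.trunc (2 / eta)).+1.
have qeta : 2 <= eta * q%:R.
  by rewrite mulrC -ler_pdivrMr// ltW// /q truncnS_gt.
pose good N (x : {ffun 'I_N * 'I_S'.+1 -> bool}) :=
  (1 - eps) * psi R r N <= Phi (sg R x) N S'.+1 r.+1 <= (1 + eps) * psi R r N.
have good_pr N : (N1 <= N)%N -> (N2 <= N)%N -> (0 < N)%N ->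
    Ex (fun x => (~~ @good N x)%:R) <= (C1 + C2) * expR (- (eta * ln N%:R)) :> R.
  move=> NN1 NN2 N0; rewrite mulrDl.
  have lN : 0 <= ln (N%:R : R) by rewrite ln_ge0// ler1n.
  have h1 : C1 * expR (- (eta1 * ln N%:R)) <= C1 * expR (- (eta * ln N%:R)).
    by rewrite ler_wpM2l// ler_expR lerN2 ler_wpM2r// ge_min lexx.
  have h2 : C2 * expR (- (eta2 * ln N%:R)) <= C2 * expR (- (eta * ln N%:R)).
    by rewrite ler_wpM2l// ler_expR lerN2 ler_wpM2r// ge_min lexx orbT.
  apply: le_trans (lerD (le_trans (H1 N NN1) h1) (le_trans (H2 N NN2) h2)).
  rewrite -ExD; apply: Ex_le => x; rewrite /good negb_and -!ltNge.
  by case: (Phi _ _ _ _ < _)%R; case: (_ < Phi _ _ _ _)%R; rewrite /= ?addr0 ?add0r// lerDl.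
pose j0 := (maxn 1 (maxn N1 N2)).
have jq j : (j <= j ^ q)%N by case: j => // j; rewrite -[leqLHS]expn1 leq_pexp2l.
have [U HU] : exists U : nat -> set T, forall j, (j0 <= j)%N ->
    [/\ measurable (U j), (P (U j) <= ((C1 + C2) / j%:R ^+ 2)%:E)%E &
      forall w, ~ U j w -> exists x, ~~ ~~ @good (j ^ q)%N x /\
      forall n s, (n < j ^ q)%N -> (s < S'.+1)%N -> e n.+1 s.+1 w = sg R x n.+1 s.+1].
  suff /choice[U HU] : forall j, exists U : set T, (j0 <= j)%N ->
    [/\ measurable U, (P U <= ((C1 + C2) / j%:R ^+ 2)%:E)%E &
      forall w, ~ U w -> exists x, ~~ ~~ @good (j ^ q)%N x /\
      forall n s, (n < j ^ q)%N -> (s < S'.+1)%N -> e n.+1 s.+1 w = sg R x n.+1 s.+1].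
    by exists U.
  move=> j; have [jj0|_] := leqP j0 j; last by exists set0.
  move: jj0; rewrite !geq_max => /and3P[j1 jN1 jN2].
  have jR : 0 < (j%:R : R) by rewrite ltr0n.
  have pr : Ex (fun x => (~~ @good (j ^ q)%N x)%:R) <= (C1 + C2) / j%:R ^+ 2 :> R.
    apply: le_trans (good_pr _ (leq_trans jN1 (jq j)) (leq_trans jN2 (jq j)) _) _.
      by rewrite expn_gt0 j1.
    rewrite ler_wpM2l ?addr_ge0// natrX lnXn// -[ln _ *+ q]mulr_natl mulrA.
    have -> : (j%:R ^+ 2)^-1 = expR (- (2 * ln j%:R)) :> R.
      by rewrite expRN expRM_natl expR_ln_nat.
    by rewrite ler_expR lerN2 ler_wpM2r// ln_ge0// ler1n.
  by have [U HU] := finite_transfer e_meas e_sign e_cyl pr; exists U.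
have := @ae_eventually_notin _ _ _ P U (C1 + C2) j0 (addr_ge0 C10 C20)
  (fun j jj => let: And3 a _ _ := HU j jj in a)
  (fun j jj => let: And3 _ b _ := HU j jj in b).
apply: filterS => w [n Hn]; apply: (sandwich (q := q)) => //.
  by move=> N N' NN; exact: Phi_mono.
exists (maxn j0 n) => j; rewrite geq_max => /andP[jj0 jn].
have [_ _ /(_ w (Hn j jn))[x [/negPn gx ex]]] := HU j jj0.
by rewrite (eq_Phi _ ex).
Qed.

Theorem theorem4 (R : realType) (d : measure_display) (T : measurableType d)
  (P : probability T R) (S : nat) (e : nat -> nat -> T -> R) :
  (0 < S)%N ->
  (forall n s, (0 < n)%N -> (0 < s <= S)%N -> measurable_fun setT (e n s)) ->
  (forall n s w, (0 < n)%N -> (0 < s <= S)%N -> e n s w = 1 \/ e n s w = -1) ->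
  (forall (N : nat) (a : 'I_N -> 'I_S -> bool),
     P [set w | forall (n : 'I_N) (s : 'I_S), e (n.+1) (s.+1) w = pm1 (a n s)]
       = ((2 ^- (N * S))%:E)%E) ->
  forall k : nat, (2 <= k)%N ->
  {ae P, forall w,
     ((fun N : nat => Phi (fun n s => e n s w) N S k
        / Num.sqrt (2 * N%:R * ln ('C(N, k.-1))%:R)) : R^nat) @ \oo --> (1 : R)}.
Proof.
move=> S0 e_meas e_sign e_cyl [//|r] r0.
(* Countably many tolerances 1/(m+2) <= 1/2 allow a single null set. *)
have ae_m (m : nat) : {ae P, forall w, exists N0, forall N, (N0 <= N)%N ->
    `|1 - Phi (fun n s => e n s w) N S r.+1 / binpsi R r N| <= 7 * (m.+2%:R)^-1}.
  apply: ae_ratio_close => //; rewrite invr_gt0 ltr0n/=.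
  by rewrite lef_pV2 ?posrE ?ltr0n// ler_nat.
have := ae_foralln ae_m; apply: filterS => w Hw.
apply/cvgrPdist_le => eps eps0.
have [m mlt] : exists m : nat, 7 / eps < m%:R.
  by exists (Num.trunc (7 / eps)).+1; rewrite truncnS_gt.
have [N0 HN] := Hw m; exists N0 => // N /= NN.
apply: (le_trans (HN N NN)).
rewrite ler_pdivrMr ?ltr0n// mulrC -ler_pdivrMr// ltW//.
by apply: (lt_trans mlt); rewrite ltr_nat; lia.
Qed.
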